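(* (Jeffreys' rule is not coherent, the independence prior is: finite analogue.) Consider the Gaussian one-way layout, with parameter $\theta_\omega=(\mu\in\mathbb R^\omega,\ \sigma^2>0)$, at a design in which every treatment group is non-empty, so that the Fisher information $I(\theta)$ is nonsingular. Jeffreys' general rule $\pi\propto\sqrt{\det I(\theta)}$ gives $$\pi^J_\omega(\mathrm d\mu,\mathrm d\sigma^2)\ \propto\ (\sigma^2)^{-(|\omega|+2)/2}\,\mathrm d\mu\,\mathrm d\sigma^2,$$ whose exponent depends on the number $|\omega|$ of the mean parameters, hence on the design. The prior obtained by treating the location parameters separately, $\pi^{\mathrm{iJ}}_\omega\propto(\sigma^2)^{-1}$, which is Jeffreys' own recommendation for the location--scale families and is called the independent Jeffreys prior in the later literature, has an exponent which does not depend on $|\omega|$. Consider the proper finite analogue, where $S$ is a finite set of squares of rational numbers and $\pi_{\omega_n}$ is uniform in $\mu$ with weight $s^{-(n+2)/2}$ in $s$, normalised. (1) A product rule $\pi_\omega=\mathrm{unif}(M^\omega)\otimes\rho_\omega$ is coherent if and only if $\rho_\omega$ does not depend on $\omega$. Hence the analogue of $\pi^{\mathrm{iJ}}$ is coherent and the analogue of $\pi^J$ is not. (2) The defect of $\pi^J$ (that is, of its finite analogue) is contained in the marginal of the dispersion. Its total variation along each of the two selections of a group is equal to the total variation between the normalisations of $s^{-3/2}$ and $s^{-2}$ on $S$, and it does not depend on $M$. For $M=\{0,1\}$ and $S=\{1,4\}$ the two marginals are $(\tfrac89,\tfrac19)$ and $(\tfrac{16}{17},\tfrac1{17})$, and the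 defect is $\tfrac8{153}$. Let $\rho_{\omega_n}$ be the normalised marginal of the dispersion of $\pi^J_{\omega_n}$. The defect along the merge is $$\tfrac12\Bigl[\bigl(1-|M|^{-1}\bigr)+\sum_{s\in S}\bigl|\,|M|^{-1}\rho_{\omega_2}(s)-\rho_{\omega_1}(s)\bigr|\Bigr]\ \ge\ 1-|M|^{-1},$$ where $1-|M|^{-1}$ is the mass of $\pi^J_{\omega_2}$ outside the diagonal. The equality holds if and only if $\rho_{\omega_1}(s)\ge|M|^{-1}\rho_{\omega_2}(s)$ for every $s$, i.e. if and only if $Z_1/Z_2\le|M|\,s_{\min}^{1/2}$, where $Z_n=\sum_{s}s^{-(n+2)/2}$ and $s_{\min}$ is the minimum of $S$. The bound is attained in every small case, for example in the one above ($M=\{0,1\}$, $S=\{1,4\}$), but it is not an identity. For $|M|=2$ and $S=\{1/4\}\cup\{(k/100)^2:105\le k\le229\}$ the defect along the merge is $0.5078\ldots>\tfrac12$.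
   Context: Gaussian one-way layout: for a finite non-empty set $\omega$ of treatments and a map $x:u\to\omega$ from a finite set $u$ of units (the treatment groups are the fibres $x^{-1}(a)$), the responses $Y_i$, $i\in u$, are independent with $Y_i\sim\mathcal N(\mu_{x(i)},\sigma^2)$. Finite one-way scheme: $M$ and $S$ are finite sets of admissible means and dispersions; the covariate spaces are $\omega_1=\{*\}$ and $\omega_2=\{1,2\}$, with the selections of a group $i_1,i_2:\omega_1\to\omega_2$, $i_k( * )=k$, and the merge $p:\omega_2\to\omega_1$. The parameter sets are $\Theta(\omega)=M^\omega\times S$, so $\Theta(\omega_n)=M^n\times S$, with $\Theta(\psi)(\mu',s)=(\mu'\circ\psi,s)$ for a map $\psi:\omega\to\omega'$; thus $\Theta(i_k)((\mu_1,\mu_2),s)=(\mu_k,s)$ and $\Theta(p)(\mu,s)=((\mu,\mu),s)$. The diagonal is the image $\{((\mu,\mu),s)\}$ of $\Theta(p)$ in $\Theta(\omega_2)$. A prior is a family of probability measures $\pi_\omega$ on $\Theta(\omega)$; in a product rule, $\rho_\omega$ is a probability vector on $S$ and $\mathrm{unif}(M^\omega)$ is the uniform distribution. The finite analogue of $\pi^J$ is the prior $\pi_{\omega_n}$ with weight $s^{-(n+2)/2}$ described in the claim; the finite analogue of $\pi^{\mathrm{iJ}}$ is uniform in $\mu$ with weight $s^{-1}$ in $s$, normalised. A prior is coherent if $\pi_\omega=\Theta(\psi)_*\pi_{\omega'}$ for every $\psi:\omega\to\omega'$ in the subcategory generated by the insertions (proper inclusions of covariate spaces); in the scheme above, identifying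 $\omega_1$ with $\{1\}$, this subcategory is generated by $i_1$. The defect of a prior along $\psi:\omega\to\omega'$ is measured by the total variation distance (half the sum of the absolute differences) between $\pi_\omega$ and $\Theta(\psi)_*\pi_{\omega'}$.
   Formalization: M and S are nonempty and S excludes 0; the analogue of π^J is claimed not coherent only for |S| ≥ 2 (it is coherent if |S| = 1); ''every small case'' is read as |M| ≥ 2 and |S| ≤ 76 (for |M| = 1, |S| ≥ 2 the bound is not attained). *)

(* Defs.v *)
From HB Require Import structures.
From mathcomp Require Import all_boot all_order all_algebra finmap.
From mathcomp Require Import all_classical all_reals all_analysis.

Set Implicit Arguments.
Unset Strict Implicit.
Unset Printing Implicit Defensive.

Import Order.TTheory GRing.Theory Num.Theory.
Import numFieldNormedType.Exports.

Local Open Scope classical_set_scope.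
Local Open Scope ring_scope.

Section GaussianLayout.
Context (R : realType) (w u : finType) (x : u -> w).

Definition mutually_independent d (Omega : measurableType d)
    (P : probability Omega R) (Y : u -> {mfun Omega >-> R}) : Prop :=
  forall (J : {set u}) (B : u -> set R), (forall i, measurable (B i)) ->
  P (\bigcap_(i in [set` J]) (Y i @^-1` B i)) =
  (\prod_(i in J) P (Y i @^-1` B i))%E.

(* [normal_prob m s] has standard deviation [s]; [v] is the variance. *)
Definition gaussian_layout d (Omega : measurableType d)
    (P : (w -> R) -> R -> probability Omega R)
    (Y : u -> {mfun Omega >-> R}) : Prop :=
  forall (mu : w -> R) (v : R), 0 < v ->
  mutually_independent (P mu v) Y /\
  forall i (B : set R), measurable B ->
    distribution (P mu v) (Y i) B = normal_prob (mu (x i)) (Num.sqrt v) B.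

Definition loglik (mu : w -> R) (v : R) (y : u -> R) : R :=
  ln (\prod_i normal_pdf (mu (x i)) (Num.sqrt v) (y i)).

(* The first #|w| coordinates of the parameter are the means, the last one is
   the variance. *)
Definition score (mu : w -> R) (v : R) (y : u -> R) (j : 'I_(#|w| + 1)) : R :=
  match fintype.split j with
  | inl a =>
      derive1 (fun t => loglik [eta mu with enum_val a |-> t] v y)
        (mu (enum_val a))
  | inr _ => derive1 (fun t => loglik mu t y) v
  end.

Section Fisher.
Context d (Omega : measurableType d)
  (P : (w -> R) -> R -> probability Omega R) (Y : u -> {mfun Omega >-> R}).

Definition fisher (mu : w -> R) (v : R) : 'M[R]_(#|w| + 1) :=
  \matrix_(j, k) fine 'E_(P mu v)[fun o =>
    score mu v (fun i => Y i o) j * score mu v (fun i => Y i o) k].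

(* Density with respect to d mu d v. *)
Definition jeffreys (mu : w -> R) (v : R) : R := Num.sqrt (\det (fisher mu v)).

(* Jeffreys' rule applied to the means with the variance held at [v0], times
   Jeffreys' rule applied to the variance with the means held at [mu0]. *)
Definition indep_jeffreys (mu0 : w -> R) (v0 : R) (mu : w -> R) (v : R) : R :=
  Num.sqrt (\det (ulsubmx (fisher mu v0))) *
  Num.sqrt (\det (drsubmx (fisher mu0 v))).

End Fisher.

Definition propto_power (f : (w -> R) -> R -> R) (e : R) : Prop :=
  exists2 c : R, 0 < c & forall mu v, 0 < v -> f mu v = c * v `^ e.

End GaussianLayout.

Section FiniteProbability.
Context (R : realType).

Definition is_prob (T : finType) (p : T -> R) : Prop :=
  (forall t, 0 <= p t) /\ \sum_t p t = 1.

Definition push (T T' : finType) (f : T -> T') (p : T -> R) (t' : T') : R :=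
  \sum_(t | f t == t') p t.

Definition tv (T : finType) (p q : T -> R) : R := 2^-1 * \sum_t `|p t - q t|.

Definition unif (T : finType) (t : T) : R := #|T|%:R^-1.

Definition normalise (T : finType) (f : T -> R) (t : T) : R :=
  f t / \sum_t' f t'.

End FiniteProbability.

Inductive cspace := w1 | w2.

Definition csize (a : cspace) : nat := match a with w1 => 1 | w2 => 2 end.

Definition pts (a : cspace) : finType := 'I_(csize a).

(* [sel 0] and [sel 1] are the selections i_1 and i_2. *)
Definition sel (k : 'I_2) : pts w1 -> pts w2 := fun=> k.

Definition wmerge : pts w2 -> pts w1 := fun=> (ord0 : 'I_1).

(* With w1 identified with the first point of w2, the only proper inclusion is
   i_1. *)
Inductive insertion_gen : forall a b : cspace, (pts a -> pts b) -> Prop :=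
| ig_insertion : @insertion_gen w1 w2 (sel ord0)
| ig_id a : @insertion_gen a a id
| ig_comp a b c (g : pts b -> pts c) (f : pts a -> pts b) :
    @insertion_gen b c g -> @insertion_gen a b f ->
    @insertion_gen a c (g \o f).

Section FiniteScheme.
Context (R : realType) (M S : {fset R}).

Definition Theta (a : cspace) : finType := ({ffun pts a -> M} * S)%type.

Definition Theta_map (a b : cspace) (psi : pts a -> pts b) (t : Theta b) :
  Theta a := ([ffun i => t.1 (psi i)], t.2).

Definition weights_family := forall a : cspace, Theta a -> R.

Definition is_prior (pi : weights_family) : Prop := forall a, is_prob (pi a).

Definition coherent (pi : weights_family) : Prop :=
  forall (a b : cspace) (psi : pts a -> pts b), insertion_gen psi ->
  pi a =1 push (Theta_map psi) (pi b).

Definition defect (pi : weights_family) (a b : cspace)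
    (psi : pts a -> pts b) : R :=
  tv (pi a) (push (Theta_map psi) (pi b)).

Definition prod_rule (rho : cspace -> S -> R) : weights_family :=
  fun a t => unif R t.1 * rho a t.2.

Definition marginal (pi : weights_family) (a : cspace) (s : S) : R :=
  push snd (pi a) s.

Definition weight (e : R) (s : S) : R := val s `^ e.

Definition finite_jeffreys : weights_family :=
  fun a => normalise (fun t : Theta a => weight (- ((csize a)%:R + 2) / 2) t.2).

Definition finite_indep_jeffreys : weights_family :=
  fun a => normalise (fun t : Theta a => weight (- 1) t.2).

Definition Zsum (n : nat) : R := \sum_(s : S) weight (- (n%:R + 2) / 2) s.

End FiniteScheme.

Arguments Theta_map {R M S a b} psi t.
Arguments coherent {R M S} pi.
Arguments defect {R M S} pi {a b} psi.
Arguments prod_rule {R M S} rho a t.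
Arguments marginal {R M S} pi a s.
Arguments weight {R S} e s.
Arguments finite_jeffreys {R} M S a t.
Arguments finite_indep_jeffreys {R} M S a t.

Definition is_fmin (R : realType) (S : {fset R}) (m : R) : Prop :=
  m \in S /\ forall s, s \in S -> m <= s.

(* The squares of nonzero rationals: a dispersion is positive. *)
Definition rat_squares (R : realType) (S : {fset R}) : Prop :=
  forall s, s \in S -> exists2 q : rat, q != 0 & s = ratr q ^+ 2.

(* Main.v *)
Require Import Defs.
From HB Require Import structures.
From mathcomp Require Import all_boot all_order all_algebra finmap.
From mathcomp Require Import all_classical all_reals all_analysis.
From mathcomp Require Import measurable_realfun.
From mathcomp Require Import ring lra.

Set Implicit Arguments.
Unset Strict Implicit.
Unset Printing Implicit Defensive.

Import Order.TTheory GRing.Theory Num.Theory.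
Import numFieldNormedType.Exports.

Local Open Scope classical_set_scope.
Local Open Scope ring_scope.

(** The layout has log-likelihood
    sum_i (- ln (2 pi v) / 2 - (y_i - mu_(x i))^2 / (2 v)), so each score is a
    sum over the units of a polynomial of degree at most two in the centred
    response e_i = y_i - mu_(x i): e_i / v for the mean of the group of i, and
    (e_i^2 - v) / (2 v^2) for the variance.  These polynomials have mean zero.
    By independence the mixed terms of the expected product of two scores
    vanish ([integral_sum_mul_indep]), and the Fisher information reduces to
    Gaussian moments up to order four.  The moments obey the recursion
    M_(k+1) = k s^2 M_(k-1), which is the statement that the derivative of
    (x - m)^k times the density has integral zero ([normal_moment_rec]).  The
    information is therefore diagonal, with n_a / v for the group a and
    N / (2 v^2) for the variance ([fisher_block]).  Its determinant is a
    constant times v^-(|w| + 2), and its variance entry alone a constant times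
    v^-2; the square roots have the two exponents.  An exponent is determined by
    the function because v^e separates exponents at v = 2 ([propto_powerP]).

    In the finite scheme both priors are product rules: uniform means times a
    dispersion law.  A selection of a group restricts maps to a point, hence
    pushes the uniform law to the uniform law and leaves the dispersion factor
    alone ([push_sel]).  So coherence compares the dispersion factors only, and
    the defect along a selection is a total variation on S.  The merge embeds
    M in M x M as the diagonal.  Off the diagonal the pushed law vanishes and
    the mass 1 - 1/|M| counts in full; on the diagonal the two laws differ by
    rho_2(s) / |M| - rho_1(s), summed over S ([tv_unif_push_inj]).  These
    differences have total 1/|M| - 1, whence the lower bound, and equality holds
    exactly when none of them is positive ([merge_defect_eq]).  With
    d = s^(1/2) this says Z_1 / Z_2 <= |M| d, which is hardest at the smallest s
    ([dispersion_le]).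

    For 2 <= |M| and |S| <= 76 the condition always holds: with w = d_0 / d the
    term of d contributes at most 27/2048 to the sum of w^3 - 2 w^4, the term
    of d_0 itself contributes -1, and 75 * 27 < 2048 ([dispersion_le_small]).
    For the set of 126 dispersions only the term at s = 1/4
    has rho_2(s) / 2 > rho_1(s), so the defect is 1/2 + 8 / Z_2 - 8 / Z_1
    ([defect_merge_strict]); the sums Z_1 and Z_2 are enclosed by telescoping
    bounds for the sums of k^-3 and k^-4. *)

(** * Moments of the normal density *)

Section NormalMoments.
Variable R : realType.
Implicit Types (m s x : R) (k n : nat).
Notation mu := (@lebesgue_measure R).

(** A density of twice the variance absorbs every power of the deviation, because
    exp t dominates each power of t.  One inequality then serves twice: it makes
    all moments finite and it makes the boundary terms below vanish. *)
Lemma normal_powpdf_le k m s : s != 0 -> exists2 C : R, 0 <= C &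
  forall x, `|(x - m) ^+ k * normal_pdf m s x| <=
    C * normal_pdf m (Num.sqrt 2 * s) x.
Proof.
move=> s0.
have s20 : Num.sqrt 2 * s != 0 by rewrite mulf_neq0// gt_eqF// sqrtr_gt0.
set a := normal_peak s; set b := normal_peak (Num.sqrt 2 * s).
have a0 : 0 < a by exact: normal_peak_gt0.
have b0 : 0 < b by exact: normal_peak_gt0.
have ss : 0 < s ^+ 2 by rewrite exprn_even_gt0.
have q0 : 0 < 4 * s ^+ 2 by rewrite pmulr_rgt0.
(* With t = y^2 / (4 s^2), |y|^k <= 1 + y^(2 k) = 1 + (4 s^2)^k t^k and
   t^k <= k! exp t; half of the exponent of the density pays for exp t. *)
pose C1 := 1 + (4 * s ^+ 2) ^+ k * k`!%:R.
have C10 : 0 <= C1.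
  by rewrite /C1 addr_ge0// mulr_ge0// exprn_ge0// mulr_ge0// ltW.
exists (C1 * a / b); first by rewrite divr_ge0 ?mulr_ge0// ltW.
move=> x; rewrite !normal_pdfE// -/a -/b /normal_fun exprMn sqr_sqrtr//.
set y := x - m.
set t := y ^+ 2 / (4 * s ^+ 2).
have t0 : 0 <= t by rewrite divr_ge0 ?sqr_ge0// mulr_ge0 ?sqr_ge0.
have -> : - y ^+ 2 / (s ^+ 2 *+ 2) = - t + - t.
  by rewrite /t; field.
have -> : - y ^+ 2 / (2 * s ^+ 2 *+ 2) = - t.
  by rewrite /t; field.
have ab : C1 * a / b * (b * expR (- t)) = C1 * (a * expR (- t)).
  by field; rewrite gt_eqF.
rewrite ab expRD !normrM normrX (gtr0_norm a0) (gtr0_norm (expR_gt0 _)).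
rewrite mulrCA [leRHS]mulrCA ler_pM2l// mulrA ler_pM2r ?expR_gt0//.
rewrite expRN -ler_pdivlMr ?invr_gt0 ?expR_gt0// invrK.
have y2 : y ^+ 2 = 4 * s ^+ 2 * t.
  by rewrite /t mulrC divfK// gt_eqF// mulr_gt0.
apply: (@le_trans _ _ (1 + (`|y| ^+ k) ^+ 2)).
  by have := sqr_ge0 (`|y| ^+ k - 1); have := sqr_ge0 (`|y| ^+ k); nra.
rewrite -exprM mulnC exprM real_normK ?num_real// y2 exprMn.
have e1 : 1 <= expR t by rewrite -expR0 ler_expR.
rewrite /C1 [leRHS]mulrDl mul1r lerD// -mulrA ler_pM2l ?exprn_gt0//.
case: k {C1 C10 ab} => [|k]; first by rewrite expr0 fact0 mul1r.
rewrite -ler_pdivrMl ?ltr0n ?fact_gt0// mulrC.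
by apply: le_trans (expR_ge1Dxn k t0); rewrite lerDr.
Qed.

Lemma measurable_powpdf k m s :
  measurable_fun [set: R] (fun x => (x - m) ^+ k * normal_pdf m s x).
Proof.
apply: measurable_funM; last exact: measurable_normal_pdf.
by apply: measurable_funX; exact: measurable_funB.
Qed.

Lemma integrable_powpdf k m s : s != 0 ->
  mu.-integrable [set: R] (fun x => ((x - m) ^+ k * normal_pdf m s x)%:E).
Proof.
move=> s0; have [C C0 le_C] := normal_powpdf_le k m s0.
have iC : mu.-integrable [set: R]
    (fun x => (C * normal_pdf m (Num.sqrt 2 * s) x)%:E).
  under eq_fun do rewrite EFinM.
  by apply: integrableZl => //; exact: integrable_normal_pdf.
apply: (le_integrable _ _ _ iC) => //.
  by apply/measurable_EFinP; exact: measurable_powpdf.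
by move=> x _; rewrite lee_fin; apply: le_trans (le_C x) _; exact: ler_norm.
Qed.

Lemma is_derive_powpdf k m s x : s != 0 ->
  is_derive x 1 (fun x => (x - m) ^+ k * normal_pdf m s x)
    (k%:R * ((x - m) ^+ k.-1 * normal_pdf m s x)
       - (s ^+ 2)^-1 * ((x - m) ^+ k.+1 * normal_pdf m s x)).
Proof.
move=> s0; rewrite normal_pdfE// /normal_fun.
have s20 : s ^+ 2 != 0 by rewrite expf_neq0.
set c := normal_peak s.
have E y : expR (- (y - m) ^+ 2 / (s ^+ 2 *+ 2)) =
    expR (- (s ^+ 2 *+ 2)^-1 * (y - m) ^+ 2) by congr expR; field.
case: k => [|k].
  rewrite [X in is_derive _ _ X _](_ : _ =
      c *: (expR \o (fun x : R => (- (s ^+ 2 *+ 2)^-1) * (x - m) ^+ 2))).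
    apply: is_derive_eq; rewrite /GRing.scale/= E.
    by set e := expR _; rewrite expr1; field.
  by apply/funext => y /=; rewrite mul1r E.
rewrite [X in is_derive _ _ X _](_ : _ = ((id - cst m) ^+ k.+1) *
    (c *: (expR \o (fun x : R => (- (s ^+ 2 *+ 2)^-1) * (x - m) ^+ 2)))).
  apply: is_derive_eq; rewrite /GRing.scale/= E.
  set e := expR _; rewrite exprfctE -[c *: e]/(c * e) -[(id - cst m) x]/(x - m).
  by rewrite !exprS expr0 mulr1; field.
by rewrite exprfctE; apply/funext => y /=; rewrite E.
Qed.

(** The fundamental theorem on the whole line for an integrand without a sign:
    integrability replaces monotonicity, by dominated convergence on the
    intervals [c - n - 1, c + n + 1]. *)
Lemma integrable_FTC2_setT (f F : R -> R) (c a b : R) :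
  mu.-integrable [set: R] (EFin \o f) -> continuous f ->
  (forall x : R, is_derive x 1 F (f x)) ->
  F (c - n.+1%:R) @[n --> \oo] --> a -> F (c + n.+1%:R) @[n --> \oo] --> b ->
  (\int[mu]_x (f x)%:E = (b - a)%:E)%E.
Proof.
move=> intf cf dF Fa Fb.
pose I n : set R := `[c - n.+1%:R, c + n.+1%:R]%classic.
have mI n : measurable (I n) by exact: measurable_itv.
have mf : measurable_fun [set: R] (EFin \o f) by case/integrableP: intf.
have FTC n : (\int[mu]_(x in I n) (f x)%:E =
    (F (c + n.+1%:R) - F (c - n.+1%:R))%:E)%E.
  rewrite (@continuous_FTC2 _ f F)//.
  - by rewrite ltrD2l gtrN.
  - exact: continuous_subspaceT.
  - have dF' (x : R) : derivable F x 1 by have [] := dF x.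
    have cF (x : R) : {for x, continuous F}.
      exact/differentiable_continuous/derivable1_diffP.
    split => //.
    + exact/cvg_at_right_filter/cF.
    + exact/cvg_at_left_filter/cF.
  - by move=> x _; rewrite derive1E derive_val.
have := @dominated_convergence _ _ _ mu [set: R] measurableT
  (fun n => ((EFin \o f) \_ (I n))) (EFin \o f) (abse \o (EFin \o f)).
case.
- by move=> n; apply/(measurable_restrictT _ (mI n)); exact: measurable_funS mf.
- exact: mf.
- apply: aeW => x _; apply: cvg_near_cst; near=> n.
  rewrite patchE ifT// inE /I/= in_itv/=.
  have : `|x - c| <= n%:R by near: n; exact: nbhs_infty_ger.
  rewrite ler_norml lerBlDr lerBrDr => /andP[h1 h2].
  by rewrite -natr1; apply/andP; split; lra.
- exact: integrable_abse.
- apply: aeW => x n _; rewrite patchE; case: ifPn => _ //=.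
  by rewrite normr0 lee_fin.
move=> _ _ lim1.
have lim2 : (\int[mu]_(x in [set: R]) ((EFin \o f) \_ (I n)) x)%E @[n --> \oo] -->
    (b - a)%:E.
  under eq_cvg do rewrite -integral_mkcond FTC.
  by apply: cvg_EFin; [exact: nearW|exact: cvgB].
exact: (cvg_unique _ lim1 lim2).
Unshelve. all: by end_near. Qed.

(** The bound for the power k + 1 leaves a factor 1 / |x - m|, which tends to 0.
    The direction z is 1 or -1. *)
Lemma cvg_powpdf k m s (z : R) : s != 0 -> `|z| = 1 ->
  (m + z * n.+1%:R - m) ^+ k * normal_pdf m s (m + z * n.+1%:R) @[n --> \oo]
    --> (0 : R).
Proof.
move=> s0 z1; have [C C0 le_C] := normal_powpdf_le k.+1 m s0.
have s20 : Num.sqrt 2 * s != 0 by rewrite mulf_neq0// gt_eqF// sqrtr_gt0.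
pose D := C * normal_peak (Num.sqrt 2 * s).
have hD : D * n.+1%:R^-1 @[n --> \oo] --> (0 : R).
  rewrite -[X in _ --> X](mulr0 D); apply: cvgMr; exact: cvg_harmonic.
apply/norm_cvg0P; apply: (squeeze_cvgr _ (cvg_cst 0) hD).
apply: nearW => n; rewrite normr_ge0/= ler_pdivlMr// mulrC.
set x := m + z * n.+1%:R.
have -> : n.+1%:R = `|x - m| by rewrite /x addrAC subrr add0r normrM z1 mul1r normr_nat.
rewrite -normrM mulrA -exprS; apply: (le_trans (le_C x)).
by rewrite ler_wpM2l// normal_pdf_ub.
Qed.

(** Integrate the derivative of (x - m)^k times the density over the line: the
    boundary terms vanish.  At k = 0 the predecessor is harmless because of the
    factor k, and the identity says that the mean is m. *)
Lemma normal_moment_rec k m s : s != 0 ->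
  (\int[mu]_x ((x - m) ^+ k.+1 * normal_pdf m s x)%:E =
   (k%:R * s ^+ 2)%:E * \int[mu]_x ((x - m) ^+ k.-1 * normal_pdf m s x)%:E)%E.
Proof.
move=> s0.
have s20 : s ^+ 2 != 0 by rewrite expf_neq0.
have i1 := integrable_powpdf k.-1 m s0; have i2 := integrable_powpdf k.+1 m s0.
have cpow j : continuous (fun x : R => (x - m) ^+ j * normal_pdf m s x).
  move=> x; apply: cvgM; last exact: continuous_normal_pdf.
  apply: (cvg_comp (fun x => x - m) (fun x => x ^+ j)); last exact: exprn_continuous.
  by apply: cvgB; [exact: cvg_id|exact: cvg_cst].
have j1 : mu.-integrable [set: R]
    (fun x => k%:R%:E * ((x - m) ^+ k.-1 * normal_pdf m s x)%:E)%E.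
  exact: integrableZl.
have j2 : mu.-integrable [set: R]
    (fun x => (s ^- 2)%:E * ((x - m) ^+ k.+1 * normal_pdf m s x)%:E)%E.
  exact: integrableZl.
pose f x := k%:R * ((x - m) ^+ k.-1 * normal_pdf m s x)
  - s ^- 2 * ((x - m) ^+ k.+1 * normal_pdf m s x).
have intf : mu.-integrable [set: R] (EFin \o f).
  by apply: (eq_integrable _ (_ \- _)%E) (integrableB _ j1 j2).
have cf : continuous f.
  move=> x; apply: (@cvgB _ R^o); apply: cvgM; by [exact: cvg_cst|exact: cpow].
have lim1 : (m - n.+1%:R - m) ^+ k * normal_pdf m s (m - n.+1%:R) @[n --> \oo]
    --> (0 : R).
  under eq_cvg do rewrite -mulN1r.
  by apply: cvg_powpdf => //; rewrite normrN1.
have lim2 : (m + n.+1%:R - m) ^+ k * normal_pdf m s (m + n.+1%:R) @[n --> \oo]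
    --> (0 : R).
  under eq_cvg do rewrite -[X in m + X]mul1r.
  by apply: cvg_powpdf => //; rewrite normr1.
have := integrable_FTC2_setT intf cf (fun x => is_derive_powpdf k m x s0) lim1 lim2.
rewrite subr0 /f.
rewrite (_ : (fun x => _) = (fun x =>
    k%:R%:E * ((x - m) ^+ k.-1 * normal_pdf m s x)%:E -
    (s ^- 2)%:E * ((x - m) ^+ k.+1 * normal_pdf m s x)%:E)%E)//.
rewrite integralB// !integralZl// => /eqP; rewrite sube_eq ?add0e; last 2 first.
- by rewrite fin_numM//; exact: integrable_fin_num.
- exact: fin_num_adde_defr.
move=> /eqP H.
rewrite mulrC EFinM -muleA H muleA -EFinM mulfV// mul1e//.
Qed.

(** Meaningful for k <= 4, the orders that enter the Fisher information. *)
Definition normal_moment s k : R :=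
  match k with 0 => 1 | 1 => 0 | 2 => s ^+ 2 | 3 => 0 | _ => 3 * s ^+ 4 end.

Lemma normal_momentE k m s : s != 0 -> (k <= 4)%N ->
  (\int[mu]_x ((x - m) ^+ k * normal_pdf m s x)%:E = (normal_moment s k)%:E)%E.
Proof.
move=> s0.
have M0 : (\int[mu]_x ((x - m) ^+ 0 * normal_pdf m s x)%:E = 1)%E.
  by under eq_integral do rewrite mul1r; exact: integral_normal_pdf.
have M1 : (\int[mu]_x ((x - m) ^+ 1 * normal_pdf m s x)%:E = 0)%E.
  by rewrite normal_moment_rec// mul0r mul0e.
have M2 : (\int[mu]_x ((x - m) ^+ 2 * normal_pdf m s x)%:E = (s ^+ 2)%:E)%E.
  by rewrite normal_moment_rec//= M0 mul1r mule1.
case: k => [|[|[|[|[|//]]]]] _ //=.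
  by rewrite normal_moment_rec//= M1 mule0.
by rewrite normal_moment_rec//= M2 -EFinM; congr EFin; ring.
Qed.
End NormalMoments.

(** * The normal law and independent random variables *)

Section NormalLaw.
Variable R : realType.
Notation mu := (@lebesgue_measure R).

(** The density is a Radon-Nikodym derivative of the law, so the change of
    variables for such derivatives applies; the two agree almost everywhere. *)
Lemma ge0_integral_normal_prob (m s : R) (f : R -> \bar R) :
  measurable_fun [set: R] f -> (forall x, 0 <= f x)%E ->
  (\int[normal_prob m s]_x f x = \int[mu]_x (f x * (normal_pdf m s x)%:E))%E.
Proof.
move=> mf f0.
have dom := normal_prob_dominates m s.
rewrite -(Radon_Nikodym_SigmaFinite.change_of_variables dom)//.
apply: ae_eq_integral => //.
- apply: emeasurable_funM => //.
  exact: measurable_int (Radon_Nikodym_SigmaFinite.f_integrable dom).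
- apply: emeasurable_funM => //.
  by apply/measurable_EFinP; exact: measurable_normal_pdf.
- apply: ae_eqe_mul2l; apply: integral_ae_eq => //.
  + exact: Radon_Nikodym_SigmaFinite.f_integrable.
  + by apply/measurable_EFinP; exact: measurable_normal_pdf.
  + by move=> E _ mE; rewrite -Radon_Nikodym_SigmaFinite.f_integral.
Qed.

(** The signed case: since the density is nonnegative, multiplying by it commutes
    with taking positive and negative parts. *)
Lemma integral_normal_prob (m s : R) (f : R -> R) :
  measurable_fun [set: R] f ->
  mu.-integrable [set: R] (fun x => (f x * normal_pdf m s x)%:E) ->
  (normal_prob m s).-integrable [set: R] (EFin \o f) /\
  (\int[normal_prob m s]_x (f x)%:E = \int[mu]_x (f x * normal_pdf m s x)%:E)%E.
Proof.
move=> mf intf.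
have mEf : measurable_fun [set: R] (EFin \o f) by exact/measurable_EFinP.
have pdf0 x : (0 <= (normal_pdf m s x)%:E)%E by rewrite lee_fin normal_pdf_ge0.
have intN : (normal_prob m s).-integrable [set: R] (EFin \o f).
  apply/integrableP; split => //.
  rewrite ge0_integral_normal_prob//; last exact: measurableT_comp.
  case/integrableP: intf => _; apply: le_lt_trans.
  rewrite le_eqVlt; apply/orP; left; apply/eqP; apply: eq_integral => x _.
  by rewrite /= -EFinM normrM (ger0_norm (normal_pdf_ge0 _ _ _)).
split=> //.
rewrite integralE [RHS]integralE; congr (_ - _)%E.
- rewrite ge0_integral_normal_prob//; last exact: measurable_funepos.
  apply: eq_integral => x _.
  by rewrite !funeposE EFinM maxe_pMl ?mul0e.
- rewrite ge0_integral_normal_prob//; last exact: measurable_funeneg.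
  apply: eq_integral => x _.
  by rewrite !funenegE EFinM -mulNe maxe_pMl ?mul0e.
Qed.

Lemma normal_prob_moment (m s : R) (k : nat) : s != 0 -> (k <= 4)%N ->
  (normal_prob m s).-integrable [set: R] (fun x => ((x - m) ^+ k)%:E) /\
  (\int[normal_prob m s]_x ((x - m) ^+ k)%:E = (normal_moment s k)%:E)%E.
Proof.
move=> s0 k4.
have [] := @integral_normal_prob m s (fun x => (x - m) ^+ k).
- by apply: measurable_funX; exact: measurable_funB.
- exact: integrable_powpdf.
by move=> ? ->; rewrite normal_momentE.
Qed.

End NormalLaw.

Section ProductOfIndependent.
Context d (Omega : measurableType d) (R : realType) (P : probability Omega R).

Lemma integrable_distribution (X : {mfun Omega >-> R}) (f : R -> R) :
  measurable_fun [set: R] f ->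
  P.-integrable [set: Omega] (EFin \o f \o X) <->
  (distribution P X).-integrable [set: R] (EFin \o f).
Proof.
move=> mf; have mEf : measurable_fun [set: R] (EFin \o f) by exact/measurable_EFinP.
split.
  move=> intf; apply/integrableP; split => //.
  rewrite ge0_integral_distribution//; last exact: measurableT_comp.
  by case/integrableP: intf.
move=> /integrableP[_ intf]; apply/integrableP; split.
  exact: measurableT_comp.
move: intf; rewrite ge0_integral_distribution//; exact: measurableT_comp.
Qed.

Variables (X Z : {mfun Omega >-> R}).
Hypothesis indep : forall A B : set R, measurable A -> measurable B ->
  P (X @^-1` A `&` Z @^-1` B) = (P (X @^-1` A) * P (Z @^-1` B))%E.

Let W (o : Omega) : R * R := (X o, Z o).

Let mW : measurable_fun [set: Omega] W.
Proof. exact: measurable_fun_pair. Qed.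

HB.instance Definition _ := isMeasurableFun.Build _ _ _ _ W mW.

Let distributionW (C : set (R * R)) : measurable C ->
  (distribution P X \x distribution P Z)%E C = distribution P W C.
Proof.
apply: product_measure_unique => A B mA mB.
by rewrite /distribution /pushforward -indep.
Qed.

(** The joint law of (X, Z) agrees with the product of the marginal laws on
    rectangles, hence everywhere, and Fubini splits the integral. *)
Lemma indep_integral_mul (f g : R -> R) :
    measurable_fun [set: R] f -> measurable_fun [set: R] g ->
    P.-integrable [set: Omega] (EFin \o f \o X) ->
    P.-integrable [set: Omega] (EFin \o g \o Z) ->
  P.-integrable [set: Omega] (fun o => (f (X o) * g (Z o))%:E) /\
  (\int[P]_o (f (X o) * g (Z o))%:E =
    \int[P]_o (f (X o))%:E * \int[P]_o (g (Z o))%:E)%E.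
Proof.
move=> mf mg intf intg.
have mEf : measurable_fun [set: R] (EFin \o f) by exact/measurable_EFinP.
have mEg : measurable_fun [set: R] (EFin \o g) by exact/measurable_EFinP.
pose h (z : R * R) : \bar R := (f z.1 * g z.2)%:E.
have mh : measurable_fun [set: R * R] h.
  apply/measurable_EFinP; apply: measurable_funM.
    exact: (measurableT_comp mf).
  exact: (measurableT_comp mg).
have iX := (integrable_distribution X mf).1 intf.
have iZ := (integrable_distribution Z mg).1 intg.
have gfin : (\int[distribution P Z]_y (g y)%:E)%E \is a fin_num.
  exact: integrable_fin_num.
have inth : (distribution P X \x distribution P Z)%E.-integrable [set: R * R] h.
  apply/integrable12ltyP => //.
  have [_ fX] := integrableP _ _ _ iX; have [_ gZ] := integrableP _ _ _ iZ.
  have c0 : (0 <= \int[distribution P Z]_y `|(EFin \o g) y|)%E.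
    exact: integral_ge0.
  have cfin : (\int[distribution P Z]_y `|(EFin \o g) y|)%E \is a fin_num.
    by rewrite ge0_fin_numE.
  under eq_integral => x _.
    under eq_integral => y _ do rewrite /h/= normrM EFinM.
    rewrite ge0_integralZl//; last first.
      by apply/measurable_EFinP; exact: measurableT_comp.
    over.
  rewrite ge0_integralZr//; last first.
    by apply/measurable_EFinP; exact: measurableT_comp.
  by rewrite muleC; exact: (lte_mul_pinfty c0 cfin fX).
have eqW (k : R * R -> \bar R) : (\int[distribution P W]_z k z =
    \int[(distribution P X \x distribution P Z)]_z k z)%E.
  by apply: eq_measure_integral => C mC _; exact/esym/distributionW.
have intP : P.-integrable [set: Omega] (h \o W).
  apply/integrableP; split; first exact: measurableT_comp.
  rewrite -(@ge0_integral_distribution _ _ _ _ _ P W (abse \o h)); last 2 first.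
  - exact: measurableT_comp.
  - by move=> z; exact: abse_ge0.
  by rewrite eqW; case/integrableP: inth.
split; first exact: intP.
rewrite -[LHS]/(\int[P]_o (h \o W) o)%E -integral_distribution// eqW.
rewrite -(@integral12_prod_meas1 _ _ _ _ _ _ _ _ inth)/fubini_F/=.
under eq_integral => x _.
  under eq_integral => y _ do rewrite /h/= EFinM.
  rewrite integralZl//.
  over.
rewrite -(fineK gfin) integralZr// fineK//.
by rewrite !integral_distribution.
Qed.

End ProductOfIndependent.

(** * The scores *)

Section Score.
Variables (R : realType) (w u : finType) (x : u -> w).
Implicit Types (mu : w -> R) (v : R) (y : u -> R).

Lemma is_derive_bigsum (I : Type) (r : seq I) (Q : pred I) (g : I -> R -> R)
    (dg : I -> R) (t : R) :
  (forall i, is_derive t 1 (g i) (dg i)) ->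
  is_derive t 1 (fun z => \sum_(i <- r | Q i) g i z) (\sum_(i <- r | Q i) dg i).
Proof.
move=> dgi; elim: r => [|i r IH].
  rewrite big_nil (_ : (fun z => _) = cst 0); first exact: is_derive_cst.
  by apply/funext => z; rewrite big_nil.
rewrite big_cons; case: ifPn => Qi; last first.
  by rewrite (_ : (fun z => _) = (fun z => \sum_(i <- r | Q i) g i z))//;
    apply/funext => z; rewrite big_cons (negbTE Qi).
rewrite (_ : (fun z => _) = (g i + (fun z => \sum_(i <- r | Q i) g i z))).
  exact: is_deriveD.
by apply/funext => z; rewrite big_cons Qi.
Qed.

Lemma loglikE mu v y : 0 < v ->
  loglik x mu v y =
  \sum_i (- (ln v + ln (pi *+ 2)) / 2 - (y i - mu (x i)) ^+ 2 / (2 * v)).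
Proof.
move=> v0; have s0 : Num.sqrt v != 0 by rewrite gt_eqF// sqrtr_gt0.
have pdf0 m z : 0 < normal_pdf m (Num.sqrt v) z.
  by rewrite normal_pdfE// mulr_gt0 ?normal_peak_gt0 ?expR_gt0.
have lnprod (r : seq u) (F : u -> R) : (forall i, 0 < F i) ->
    ln (\prod_(i <- r) F i) = \sum_(i <- r) ln (F i).
  move=> F0; elim: r => [|i r IH]; first by rewrite !big_nil ln1.
  by rewrite !big_cons lnM ?posrE ?IH// prodr_gt0.
rewrite /loglik lnprod//; apply: eq_bigr => i _.
rewrite normal_pdfE// lnM ?posrE ?normal_peak_gt0 ?expR_gt0//.
rewrite /normal_fun expRK /normal_peak sqr_sqrtr ?(ltW v0)//; congr (_ + _).
  rewrite lnV ?posrE; last first.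
    by rewrite sqrtr_gt0 mulrn_wgt0// mulr_gt0 ?pi_gt0.
  rewrite -mulrnAr -powR12_sqrt; last first.
    by rewrite mulr_ge0 ?(ltW v0)// mulrn_wge0// pi_ge0.
  rewrite ln_powR lnM ?posrE//; last by rewrite mulrn_wgt0 ?pi_gt0.
  by rewrite mulrC mulNr.
by rewrite mulNr mulr_natl.
Qed.

(** The contribution of unit i to score j, as a polynomial in the centred
    response. *)
Definition score_term v (j : 'I_(#|w| + 1)) (i : u) (e : R) : R :=
  match fintype.split j with
  | inl a => (x i == enum_val a)%:R * (e / v)
  | inr _ => (e ^+ 2 - v) / (2 * v ^+ 2)
  end.

(** The shape of one summand of the log-likelihood as a function of the
    variance. *)
Lemma is_derive_log_inv (c k t : R) : 0 < t ->
  is_derive t 1 (fun v : R => c - 2^-1 * ln v - k * v^-1)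
    (- 2^-1 * t^-1 + k * t ^- 2).
Proof.
move=> t0; have tn0 : t != 0 by rewrite gt_eqF.
have dln : is_derive t 1 (@ln R) t^-1 by exact: is_derive1_ln.
have dV : is_derive t 1 (fun v : R => v^-1) (- t ^- 2).
  have id1 : derivable (@id R) t 1 by exact: derivable_id.
  apply: DeriveDef; first exact: (@derivableV _ _ (@id R)).
  by rewrite (@deriveV _ _ (@id R))// derive_id /GRing.scale/= mulr1.
rewrite (_ : (fun v => _) =
    cst c - 2^-1 *: (@ln R) - k *: (fun v : R => v^-1)); last exact/funext.
apply: is_derive_eq.
by rewrite /GRing.scale/=; ring.
Qed.

Lemma scoreE mu v y j : 0 < v ->
  score x mu v y j = \sum_i score_term v j i (y i - mu (x i)).
Proof.
move=> v0; have vn0 : v != 0 by rewrite gt_eqF.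
rewrite /score /score_term; case: fintype.split => [a|_].
  set b := enum_val a.
  under eq_fun do rewrite loglikE//.
  rewrite derive1E; apply: derive_val.
  apply: is_derive_bigsum => i /=.
  rewrite /fun_if/=; case: (eqVneq (x i) b) => [->|_]; last first.
    by rewrite mul0r; exact: is_derive_cst.
  rewrite mul1r; apply: is_derive_eq.
  by rewrite /GRing.scale/=; field.
rewrite derive1E; apply: derive_val.
apply: (@near_eq_is_derive _ _ _ (fun t => \sum_i
    (- ln (pi *+ 2) / 2 - 2^-1 * ln t - (y i - mu (x i)) ^+ 2 / 2 * t^-1))).
  near=> t; rewrite loglikE; last by near: t; exact: lt_nbhsr.
  by apply: eq_bigr => i _; rewrite invfM; ring.
apply: is_derive_bigsum => i.
rewrite [X in is_derive _ _ _ X](_ : _ =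
    - 2^-1 * v^-1 + (y i - mu (x i)) ^+ 2 / 2 * v ^- 2).
  exact: is_derive_log_inv.
by field.
Unshelve. all: by end_near. Qed.
End Score.

(** * The Fisher information and the two rules of Jeffreys *)

Section NormalRandomVariable.
Context (R : realType).

(** The normal law lives on the line with the sigma-algebra generated by the
    half-open intervals, the responses take values in the line with its Borel
    structure.  The structures have the same measurable sets but are different
    types; the identity, seen as a random variable, carries one to the other. *)
Let toR : measurableTypeR R -> R := idfun.

#[local] HB.instance Definition _ :=
  @isMeasurableFun.Build _ _ _ _ toR (@measurable_id _ _ setT).

Lemma normal_rv_moment d (Omega : measurableType d) (P : probability Omega R)
    (Y : {mfun Omega >-> R}) (m s : R) (k : nat) :
  s != 0 -> (k <= 4)%N ->
  (forall B : set R, measurable B -> distribution P Y B = normal_prob m s B) ->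
  P.-integrable [set: Omega] (fun o => ((Y o - m) ^+ k)%:E) /\
  (\int[P]_o ((Y o - m) ^+ k)%:E = (normal_moment s k)%:E)%E.
Proof.
move=> s0 k4 distY; have [iN eN] := normal_prob_moment m s0 k4.
have eqN (f : R -> \bar R) : (\int[distribution P Y]_z f z =
    \int[distribution (normal_prob m s) toR]_z f z)%E.
  by apply: eq_measure_integral => B mB _; exact: distY.
have mk : measurable_fun [set: R] (fun z : R => (z - m) ^+ k).
  by apply: measurable_funX; exact: measurable_funB.
have mEk : measurable_fun [set: R] (EFin \o (fun z : R => (z - m) ^+ k)).
  exact/measurable_EFinP.
have iN' := (@integrable_distribution _ _ _ (normal_prob m s) toR _ mk).1 iN.
have iY : (distribution P Y).-integrable [set: R] (EFin \o (fun z => (z - m) ^+ k)).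
  apply/integrableP; split => //.
  by rewrite eqN; case/integrableP: iN'.
have iP := (@integrable_distribution _ _ _ P Y _ mk).2 iY.
split; first exact: iP.
by rewrite -eN -[LHS](integral_distribution _ iP)// eqN integral_distribution.
Qed.

End NormalRandomVariable.

Section IndependentSums.
Context (R : realType) (u : finType).
Context d (Omega : measurableType d) (P : probability Omega R).

(** Every integral in the Fisher information is the mean of a polynomial of
    degree at most four in a centred response. *)
Lemma normal_quartic (Y : {mfun Omega >-> R}) (m v c0 c1 c2 c3 c4 : R) :
  0 < v ->
  (forall B : set R, measurable B ->
    distribution P Y B = normal_prob m (Num.sqrt v) B) ->
  let q (e : R) := c0 + c1 * e + c2 * e ^+ 2 + c3 * e ^+ 3 + c4 * e ^+ 4 in
  P.-integrable [set: Omega] (fun o => (q (Y o - m))%:E) /\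
  (\int[P]_o (q (Y o - m))%:E = (c0 + c2 * v + c4 * (3 * v ^+ 2))%:E)%E.
Proof.
move=> v0 distY q.
pose c (k : 'I_5) := nth 0 [:: c0; c1; c2; c3; c4] k.
have qE e : q e = \sum_(k < 5) c k * e ^+ k.
  by rewrite !big_ord_recl big_ord0 /q /c/= mulr1 expr1 !addrA addr0.
have s0 : Num.sqrt v != 0 by rewrite gt_eqF// sqrtr_gt0.
have s2 : Num.sqrt v ^+ 2 = v by rewrite sqr_sqrtr// ltW.
have moment (k : 'I_5) := normal_rv_moment s0 (ltn_ord k) distY.
have iterm k : P.-integrable [set: Omega] (fun o => ((c k)%:E * ((Y o - m) ^+ k)%:E)%E).
  by apply: integrableZl => //; have [] := moment k.
have qS o : ((q (Y o - m))%:E = \sum_(k < 5) (c k)%:E * ((Y o - m) ^+ k)%:E)%E.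
  by rewrite qE -sumEFin; apply: eq_bigr => k _; rewrite EFinM.
split.
  by rewrite (funext qS); exact: integrable_sum.
under eq_integral do rewrite qS.
rewrite integral_sum//.
under eq_bigr => k _.
  have [ik ek] := moment k.
  rewrite integralZl// ek -EFinM.
  over.
rewrite sumEFin !big_ord_recl big_ord0 /c/= s2 (_ : 4 = 2 * 2)%N// exprM s2.
by congr EFin; ring.
Qed.

(** For independent responses and centred summands f_i, the product of two sums
    has no mixed terms in the mean. *)
Lemma integral_sum_mul_indep (Y : u -> {mfun Omega >-> R}) (f g : u -> R -> R) :
  mutually_independent P Y ->
  (forall i, measurable_fun [set: R] (f i)) ->
  (forall i, measurable_fun [set: R] (g i)) ->
  (forall i, P.-integrable [set: Omega] (fun o => (f i (Y i o))%:E)) ->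
  (forall i, P.-integrable [set: Omega] (fun o => (g i (Y i o))%:E)) ->
  (forall i, P.-integrable [set: Omega] (fun o => (f i (Y i o) * g i (Y i o))%:E)) ->
  (forall i, \int[P]_o (f i (Y i o))%:E = 0)%E ->
  (\int[P]_o ((\sum_i f i (Y i o)) * (\sum_i g i (Y i o)))%:E =
   \sum_i \int[P]_o (f i (Y i o) * g i (Y i o))%:E)%E.
Proof.
move=> indY mf mg intf intg intfg f0.
have pair i k : i != k ->
    P.-integrable [set: Omega] (fun o => (f i (Y i o) * g k (Y k o))%:E) /\
    (\int[P]_o (f i (Y i o) * g k (Y k o))%:E =
      \int[P]_o (f i (Y i o))%:E * \int[P]_o (g k (Y k o))%:E)%E.
  move=> ik; apply: (indep_integral_mul _ (mf i) (mg k) (intf i) (intg k)) => A B mA mB.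
  (* Independence is stated for families of events; only i and k matter. *)
  pose C j := if j == i then A else B.
  have mC j : measurable (C j) by rewrite /C; case: ifP.
  have := indY [set i; k]%SET C mC.
  rewrite big_setU1 ?inE//= big_set1 /C eqxx (eq_sym k) (negbTE ik) => <-.
  congr (P _); apply/seteqP; split => o.
    move=> [oA oB] j /=; rewrite !inE => /orP[|] /eqP ->; first by rewrite eqxx.
    by rewrite eq_sym (negbTE ik).
  move=> H; split; [have := H i|have := H k].
    by rewrite eqxx; apply; rewrite /= !inE eqxx.
  by rewrite eq_sym (negbTE ik); apply; rewrite /= !inE eqxx orbT.
have intp i k : P.-integrable [set: Omega] (fun o => (f i (Y i o) * g k (Y k o))%:E).
  by have [->|/pair[]] := eqVneq i k.
have sumE o : (((\sum_i f i (Y i o)) * (\sum_i g i (Y i o)))%:E =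
    \sum_i \sum_k (f i (Y i o) * g k (Y k o))%:E)%E.
  rewrite big_distrl -sumEFin; apply: eq_bigr => i _ /=.
  by rewrite big_distrr -sumEFin.
under eq_integral do rewrite sumE.
rewrite integral_sum//; last by move=> i; exact: integrable_sum.
apply: eq_bigr => i _; rewrite integral_sum// (bigD1 i)//= big1 ?adde0// => k ki.
have [|_ ->] := pair i k; first by rewrite eq_sym.
by rewrite f0 mul0e.
Qed.

End IndependentSums.

(** The exponent is determined: v = 1 fixes the constant, and v = 2 then fixes
    the exponent since ln 2 is not 0. *)
Lemma propto_powerP (R : realType) (w : finType) (f : (w -> R) -> R -> R)
    (c e0 e : R) :
  0 < c -> (forall mu v, 0 < v -> f mu v = c * v `^ e0) ->
  propto_power f e <-> e = e0.
Proof.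
move=> c0 fE; split=> [[c' c'0 fE']|->]; last by exists c.
have eqp v : 0 < v -> c' * v `^ e = c * v `^ e0.
  by move=> v0; rewrite -(fE' (fun=> 0))// fE.
have cc : c' = c by have := eqp 1 ltr01; rewrite powR1 !mulr1.
have /(mulfI (lt0r_neq0 c0)) : c * 2 `^ e = c * 2 `^ e0 by rewrite -{1}cc eqp.
move/(congr1 (@ln R)); rewrite !ln_powR.
by apply: mulIf; rewrite gt_eqF// ln_gt0// ltr1n.
Qed.

Section FisherMatrix.
Context (R : realType) (w u : finType) (x : u -> w).
Context d (Omega : measurableType d)
  (P : (w -> R) -> R -> probability Omega R) (Y : u -> {mfun Omega >-> R}).

Let group (a : w) : R := #|[set i | x i == a]%SET|%:R.

(** The covariance of the contributions of unit i to two scores.  The entries for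
    one mean and the variance vanish with the odd moments; the last one is the
    variance 2 v^2 of e^2, divided by 4 v^4. *)
Definition score_cov (v : R) (j k : 'I_(#|w| + 1)) (i : u) : R :=
  match fintype.split j, fintype.split k with
  | inl a, inl b => (x i == enum_val a)%:R * (x i == enum_val b)%:R / v
  | inr _, inr _ => (2 * v ^+ 2)^-1
  | _, _ => 0
  end.

Lemma fisherE (mu : w -> R) (v : R) : gaussian_layout x P Y -> 0 < v ->
  fisher x P Y mu v = \matrix_(j, k) \sum_i score_cov v j k i.
Proof.
move=> layout v0; have [indY distY] := layout mu v v0.
have vn0 : v != 0 by rewrite gt_eqF.
apply/matrixP => j k; rewrite !mxE unlock.
have quartic i (f : R -> R) c0 c1 c2 c3 c4 :
    (forall e, f e = c0 + c1 * e + c2 * e ^+ 2 + c3 * e ^+ 3 + c4 * e ^+ 4) ->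
    (P mu v).-integrable [set: Omega] (fun o => (f (Y i o - mu (x i)))%:E) /\
    (\int[P mu v]_o (f (Y i o - mu (x i)))%:E =
      (c0 + c2 * v + c4 * (3 * v ^+ 2))%:E)%E.
  move=> fE; rewrite (funext fE : f = _).
  exact: (normal_quartic _ _ _ _ _ v0 (distY i)).
have mscore l i : measurable_fun [set: R]
    (fun z => score_term x v l i (z - mu (x i))).
  apply: (measurableT_comp (f := score_term x v l i)); last exact: measurable_funB.
  rewrite /score_term; case: fintype.split => [a|_].
    by apply: measurable_funM => //; exact: measurable_funM.
  by apply: measurable_funM => //; apply: measurable_funB => //; exact: measurable_funX.
have mean0 l i : (P mu v).-integrable [set: Omega]
      (fun o => (score_term x v l i (Y i o - mu (x i)))%:E) /\
    (\int[P mu v]_o (score_term x v l i (Y i o - mu (x i)))%:E = 0)%E.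
  rewrite /score_term; case: fintype.split => [a|_].
    set c := (x i == _)%:R.
    have [|? ->] := quartic i (fun e => c * (e / v)) 0 (c / v) 0 0 0.
      by move=> e; ring.
    by split=> //; congr EFin; ring.
  have [|? ->] := quartic i (fun e => (e ^+ 2 - v) / (2 * v ^+ 2))
      (- v / (2 * v ^+ 2)) 0 (2 * v ^+ 2)^-1 0 0.
    by move=> e; ring.
  by split=> //; congr EFin; field.
have cov i : (P mu v).-integrable [set: Omega] (fun o =>
      (score_term x v j i (Y i o - mu (x i)) *
       score_term x v k i (Y i o - mu (x i)))%:E) /\
    (\int[P mu v]_o (score_term x v j i (Y i o - mu (x i)) *
       score_term x v k i (Y i o - mu (x i)))%:E = (score_cov v j k i)%:E)%E.
  rewrite /score_term /score_cov.
  case: (fintype.split j) => [a|_]; case: (fintype.split k) => [b|_].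
  - set c := (x i == _)%:R; set c' := (x i == _)%:R.
    have [|? ->] := quartic i (fun e => c * (e / v) * (c' * (e / v)))
      0 0 (c * c' / v ^+ 2) 0 0; first by move=> e; field.
    by split=> //; congr EFin; field.
  - set c := (x i == _)%:R.
    have [|? ->] := quartic i (fun e => c * (e / v) * ((e ^+ 2 - v) / (2 * v ^+ 2)))
      0 (- c / (2 * v ^+ 2)) 0 (c / (2 * v ^+ 3)) 0; first by move=> e; field.
    by split=> //; congr EFin; ring.
  - set c := (x i == _)%:R.
    have [|? ->] := quartic i (fun e => (e ^+ 2 - v) / (2 * v ^+ 2) * (c * (e / v)))
      0 (- c / (2 * v ^+ 2)) 0 (c / (2 * v ^+ 3)) 0; first by move=> e; field.
    by split=> //; congr EFin; ring.
  - have [|? ->] := quartic i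
      (fun e => (e ^+ 2 - v) / (2 * v ^+ 2) * ((e ^+ 2 - v) / (2 * v ^+ 2)))
      (4 * v ^+ 2)^-1 0 (- (2 * v ^+ 3)^-1) 0 (4 * v ^+ 4)^-1.
      by move=> e; field.
    by split=> //; congr EFin; field.
under eq_integral do rewrite !scoreE//.
rewrite (integral_sum_mul_indep indY (mscore j) (mscore k)).
- by under eq_bigr do rewrite (cov _).2; rewrite sumEFin.
- by move=> i; exact: (mean0 j i).1.
- by move=> i; exact: (mean0 k i).1.
- by move=> i; exact: (cov i).1.
- by move=> i; exact: (mean0 j i).2.
Qed.

(** A unit lies in one group only, so different means are uncorrelated. *)
Lemma fisher_block (mu : w -> R) (v : R) : gaussian_layout x P Y -> 0 < v ->
  fisher x P Y mu v =
  block_mx (diag_mx (\row_a (group (enum_val a) / v))) 0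
           0 (#|u|%:R / (2 * v ^+ 2))%:M.
Proof.
move=> layout v0; rewrite fisherE//; apply/matrixP => j k.
rewrite -(splitK j) -(splitK k) !mxE !unsplitK /score_cov.
case: (fintype.split j) => [a|a']; case: (fintype.split k) => [b|b'];
  rewrite !(unsplitK, mxE); last 3 first.
- by rewrite big1.
- by rewrite big1.
- by rewrite !ord1 eqxx mulr1n sumr_const [RHS]mulr_natl.
rewrite -mulr_suml -mulrnAl /group; congr (_ / v).
have [->|ab] := eqVneq a b.
  rewrite mulr1n -sum1_card natr_sum [RHS]big_mkcond/=.
  by apply: eq_bigr => i _; rewrite -natrM mulnb andbb inE; case: (_ == _).
rewrite mulr0n big1// => i _; rewrite -natrM mulnb.
case: eqP => //= ->; case: eqP => // /enum_val_inj abE.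
by rewrite abE eqxx in ab.
Qed.
Hypothesis x_surj : forall a, exists i, x i = a.

Let group_gt0 a : 0 < group a.
Proof.
have [i xi] := x_surj a; rewrite ltr0n card_gt0.
by apply/set0Pn; exists i; rewrite inE xi.
Qed.

Hypothesis w_gt0 : (0 < #|w|)%N.
Hypothesis layout : gaussian_layout x P Y.

Let units_gt0 : 0 < #|u|%:R :> R.
Proof.
have /card_gt0P[a _] := w_gt0.
have [i _] := x_surj a; rewrite ltr0n.
by apply/card_gt0P; exists i.
Qed.

Let det_means (v : R) :
  \det (diag_mx (\row_(a < #|w|) (group (enum_val a) / v))) =
  (\prod_(a < #|w|) group (enum_val a)) * v ^- #|w|.
Proof.
rewrite det_diag; under eq_bigr do rewrite mxE.
by rewrite big_split/= prodr_const card_ord exprVn.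
Qed.

Let groups_gt0 : 0 < \prod_(a < #|w|) group (enum_val a).
Proof. by apply: prodr_gt0 => a _. Qed.

Lemma det_fisher (mu : w -> R) (v : R) : 0 < v ->
  \det (fisher x P Y mu v) =
  (\prod_(a < #|w|) group (enum_val a) * (#|u|%:R / 2)) * v ^- (#|w| + 2).
Proof.
move=> v0; rewrite fisher_block// det_ublock det_means det_scalar1.
by rewrite exprD !invfM; ring.
Qed.

Lemma fisher_unit (mu : w -> R) (v : R) : 0 < v -> fisher x P Y mu v \in unitmx.
Proof.
move=> v0; rewrite unitmxE unitfE det_fisher// gt_eqF//.
by rewrite !mulr_gt0 ?invr_gt0 ?exprn_gt0.
Qed.

Lemma sqrt_expN (v : R) (n : nat) : 0 < v ->
  Num.sqrt (v ^- n) = v `^ (- n%:R / 2).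
Proof.
move=> v0; rewrite -powR12_sqrt ?invr_ge0 ?exprn_ge0 ?(ltW v0)//.
by rewrite -powR_invn ?(ltW v0)// -powRrM.
Qed.

Lemma jeffreys_propto (e : R) :
  propto_power (jeffreys x P Y) e <-> e = - (#|w|%:R + 2) / 2.
Proof.
apply: (@propto_powerP _ _ _
  (Num.sqrt (\prod_(a < #|w|) group (enum_val a) * (#|u|%:R / 2)))).
  by rewrite sqrtr_gt0 !mulr_gt0 ?invr_gt0.
move=> mu v v0; rewrite /jeffreys det_fisher// sqrtrM; last first.
  by rewrite ltW// !mulr_gt0 ?invr_gt0.
by rewrite sqrt_expN// natrD.
Qed.

Lemma indep_jeffreys_propto (mu0 : w -> R) (v0 e : R) : 0 < v0 ->
  propto_power (indep_jeffreys x P Y mu0 v0) e <-> e = - 1.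
Proof.
move=> v00.
apply: (@propto_powerP _ _ _
  (Num.sqrt (\prod_(a < #|w|) group (enum_val a) * v0 ^- #|w|) *
   Num.sqrt (#|u|%:R / 2))).
  by rewrite mulr_gt0// sqrtr_gt0 ?mulr_gt0 ?invr_gt0 ?exprn_gt0.
move=> mu v v_gt0; rewrite /indep_jeffreys !fisher_block//.
rewrite block_mxKul block_mxKdr det_means det_scalar1 -mulrA; congr (_ * _).
rewrite invfM mulrA sqrtrM ?divr_ge0// sqrt_expN//.
by congr (_ * _ `^ _); field.
Qed.

End FisherMatrix.

(** * Product measures on finite sets *)

Section FiniteProbabilityLemmas.
Context (R : realType).
Implicit Types (A B T : finType).

Lemma sum_unif (A : finType) : (0 < #|A|)%N -> \sum_(a : A) unif R a = 1.
Proof.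
move=> A0; rewrite /unif sumr_const -[LHS]mulr_natl divff// pnatr_eq0 -lt0n//.
Qed.

Lemma sum_prod (A B : finType) (p : A -> R) (r : B -> R) :
  \sum_(t : A * B) p t.1 * r t.2 = (\sum_a p a) * (\sum_b r b).
Proof.
rewrite mulr_suml; under [RHS]eq_bigr do rewrite mulr_sumr.
by rewrite pair_bigA.
Qed.

Lemma normalise_snd (A B : finType) (f : B -> R) (t : A * B) :
  (0 < #|A|)%N ->
  normalise (fun t : A * B => f t.2) t = unif R t.1 * normalise f t.2.
Proof.
move=> A0; rewrite /normalise /unif.
have -> : \sum_(t' : A * B) f t'.2 = #|A|%:R * \sum_b f b.
  under eq_bigr do rewrite -[f _]mul1r.
  by rewrite (sum_prod (fun=> 1)) sumr_const.
by rewrite invfM mulrCA mulrA.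
Qed.

(** A map that acts on the first factor only leaves the second factor of a
    product law alone; in the scheme the second factor is the dispersion. *)
Lemma push_map_fst (A A' B : finType) (f : A -> A') (p : A -> R) (r : B -> R) :
  push (fun t : A * B => (f t.1, t.2)) (fun t => p t.1 * r t.2) =1
  (fun t => push f p t.1 * r t.2).
Proof.
move=> [a' b]; rewrite /push /= mulr_suml.
rewrite (eq_bigl (fun t : A * B => (f t.1 == a') && (t.2 == b)))//.
rewrite -(pair_big (fun a => f a == a') (fun b' => b' == b)
  (fun a b' => p a * r b'))/=.
by apply: eq_bigr => a _; rewrite big_pred1_eq.
Qed.

Lemma push_snd (A B : finType) (p : A -> R) (r : B -> R) (b : B) :
  \sum_a p a = 1 -> push snd (fun t : A * B => p t.1 * r t.2) b = r b.
Proof.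
move=> p1; rewrite /push.
rewrite -(pair_big xpredT (fun b' => b' == b) (fun a b' => p a * r b'))/=.
by under eq_bigr do rewrite big_pred1_eq; rewrite -mulr_suml p1 mul1r.
Qed.

Lemma is_prob_normalise (T : finType) (f : T -> R) :
  (forall t, 0 <= f t) -> 0 < \sum_t f t -> is_prob (normalise f).
Proof.
move=> f0 sf; split; first by move=> t; rewrite divr_ge0// ltW.
by rewrite -mulr_suml divff// gt_eqF.
Qed.

Lemma is_prob_prod (A B : finType) (p : A -> R) (r : B -> R) :
  is_prob p -> is_prob r -> is_prob (fun t : A * B => p t.1 * r t.2).
Proof.
move=> [p0 p1] [r0 r1]; split; first by move=> t; rewrite mulr_ge0.
by rewrite sum_prod p1 r1 mulr1.
Qed.

Lemma is_prob_unif (A : finType) : (0 < #|A|)%N -> is_prob (@unif R A).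
Proof. by move=> A0; split; [move=> a; rewrite invr_ge0|exact: sum_unif]. Qed.

Lemma tv_prod (A B : finType) (p : A -> R) (r r' : B -> R) : is_prob p ->
  tv (fun t : A * B => p t.1 * r t.2) (fun t => p t.1 * r' t.2) = tv r r'.
Proof.
move=> [p0 p1]; rewrite /tv; congr (_ * _).
under eq_bigr => t _ do rewrite -mulrBr normrM (ger0_norm (p0 _)).
by rewrite (sum_prod p (fun b => `|r b - r' b|)) p1 mul1r.
Qed.

(** The nonnegative numbers |f t| - f t have sum zero. *)
Lemma sum_norm_eq (T : finType) (f : T -> R) :
  \sum_t `|f t| = \sum_t f t <-> forall t, 0 <= f t.
Proof.
split=> [fE t|f0]; last by apply: eq_bigr => t _; rewrite ger0_norm.
have : \sum_t (`|f t| - f t) = 0 by rewrite big_split/= sumrN fE subrr.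
move/eqP; rewrite psumr_eq0; last by move=> s _; rewrite subr_ge0 ler_norm.
by move/allP => /(_ t (mem_index_enum _))/=; rewrite subr_eq0 => /eqP <-.
Qed.

End FiniteProbabilityLemmas.

(** The merge acts on the means as the diagonal embedding.  For any injection f
    of A in A', the uniform law of A is carried to the uniform law of the image,
    which has mass q under the uniform law of A'. *)
Section PushInjective.
Context (R : realType) (A A' B : finType) (f : A -> A').
Hypotheses (f_inj : injective f) (A0 : (0 < #|A|)%N) (A'0 : (0 < #|A'|)%N).
Let q : R := #|A|%:R / #|A'|%:R.

Lemma push_inj (p : A -> R) (a' : A') : push f p a' =
  if [pick a | f a == a'] is Some a then p a else 0.
Proof.
rewrite /push; case: pickP => [a /eqP <-|no].
  by rewrite (big_pred1 a)// => b; rewrite /= (inj_eq f_inj).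
by rewrite big_pred0.
Qed.

Lemma push_unif_inj (a' : A') :
  push f (@unif R A) a' = if a' \in codom f then #|A|%:R^-1 else 0.
Proof.
rewrite push_inj; case: pickP => [a /eqP <-|no]; first by rewrite codom_f.
by case: codomP => // -[a E]; have := no a; rewrite E eqxx.
Qed.

Lemma sum_codom (c : R) : \sum_(a' in codom f) c = #|A|%:R * c.
Proof. by rewrite sumr_const card_codom// mulr_natl. Qed.

Lemma sum_unif_codom : \sum_(a' in codom f) unif R a' = q.
Proof. exact: sum_codom. Qed.

Lemma sum_unif_notin_codom : \sum_(a' | a' \notin codom f) unif R a' = 1 - q.
Proof.
apply/eqP; rewrite eq_sym subr_eq addrC -sum_unif_codom -(sum_unif R A'0).
by rewrite (bigID (mem (codom f))).
Qed.

Lemma unif_mass_outside (r : B -> R) : \sum_b r b = 1 ->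
  \sum_(t | t \notin codom (fun t : A * B => (f t.1, t.2)))
    unif R t.1 * r t.2 = 1 - q.
Proof.
move=> r1; rewrite (eq_bigl (fun t : A' * B => (t.1 \notin codom f) && true)).
  rewrite -(pair_big (fun a' => a' \notin codom f) xpredT
    (fun a' b => unif R a' * r b))/=.
  under eq_bigr do rewrite -mulr_sumr r1 mulr1.
  exact: sum_unif_notin_codom.
move=> [a' b]; rewrite andbT; congr (~~ _).
apply/codomP/codomP => [[[a b'] [-> _]]|[a E]]; first by exists a.
by exists (a, b); rewrite /= -E.
Qed.

(** Outside the image only the first law has mass, 1 - q in total.  On each fibre
    over the image the two laws differ by r / |A'| - r' / |A|, and there are |A|
    fibres. *)
Lemma tv_unif_push_inj (r r' : B -> R) :
  (forall b, 0 <= r b) -> \sum_b r b = 1 ->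
  tv (fun t : A' * B => unif R t.1 * r t.2)
     (push (fun t : A * B => (f t.1, t.2)) (fun t => unif R t.1 * r' t.2)) =
  2^-1 * ((1 - q) + \sum_b `|q * r b - r' b|).
Proof.
move=> r0 r1; rewrite /tv; congr (_ * _).
under eq_bigr => t _ do rewrite push_map_fst push_unif_inj.
rewrite -(pair_bigA _ (fun a' b => `|unif R a' * r b -
   (if a' \in codom f then #|A|%:R^-1 else 0) * r' b|))/=.
rewrite (bigID (mem (codom f)))/= addrC; congr (_ + _).
  rewrite -sum_unif_notin_codom; apply: eq_bigr => a' /negbTE ->.
  under eq_bigr => b _ do rewrite mul0r subr0 ger0_norm ?mulr_ge0 ?invr_ge0//.
  by rewrite -mulr_sumr r1 mulr1.
under eq_bigr => a' -> do [].
rewrite exchange_big/=; apply: eq_bigr => b _.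
rewrite /unif sum_codom -[X in X * _](ger0_norm (ler0n R _)) -normrM.
have nA : #|A|%:R != 0 :> R by rewrite pnatr_eq0 -lt0n.
by rewrite /q; congr `|_|; rewrite mulrBr mulrA mulVKf.
Qed.

End PushInjective.

(** Evaluation at a point: each value is attained by |K| of the |K|^2 maps. *)
Lemma push_unif_eval (R : realType) (K : finType) (k : 'I_2)
    (h : {ffun 'I_1 -> K}) : (0 < #|K|)%N ->
  push (fun g : {ffun 'I_2 -> K} => [ffun i : 'I_1 => g k])
    (@unif R _) h = unif R h.
Proof.
move=> K0; have K0' : #|K|%:R != 0 :> R by rewrite pnatr_eq0 -lt0n.
(* The fibre of the evaluation is a product of sets: a point at k, everything
   elsewhere. *)
pose F (i : 'I_2) : pred K := if i == k then pred1 (h ord0) else predT.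
rewrite /push /unif (eq_bigl (mem (family F))); last first.
  move=> g; rewrite -[RHS]/(g \in family F).
  apply/eqP/familyP => [gh i|gF].
    by rewrite /F -gh; case: eqP => [->|]; rewrite inE// ffunE.
  apply/ffunP => i; rewrite ffunE ord1.
  by have := gF k; rewrite /F eqxx inE => /eqP.
rewrite sumr_const card_family !card_ffun !card_ord -[LHS]mulr_natl.
have -> : foldr muln 1%N [seq #|F i| | i : 'I_2] = #|K|.
  rewrite /image_mem enum_ordSl enum_ordSl (size0nil (size_enum_ord 0))/= muln1.
  have Fk : #|F k| = 1%N by rewrite /F eqxx card1.
  have Fi i : i != k -> #|F i| = #|K| by move=> /negbTE ik; rewrite /F ik.
  case: (unliftP ord0 k) Fk Fi => [j ->|->]; rewrite ?ord1 => Fk Fi.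
    by rewrite Fk muln1 Fi.
  by rewrite Fk mul1n Fi.
by rewrite expn1 natrX; field.
Qed.

(** * The finite one-way scheme *)

Local Open Scope fset_scope.
Local Open Scope ring_scope.

Section CoherenceOfProductRules.
Context (R : realType) (M S : {fset R}).
Hypotheses (M0 : M != fset0).

Lemma card_fset_gt0 (K : {fset R}) : K != fset0 -> (0 < #|{: K}|)%N.
Proof. by rewrite -cardfE cardfs_gt0. Qed.

Let cM0 : (0 < #|{: M}|)%N. Proof. exact: card_fset_gt0. Qed.

Let cffun_gt0 (a : cspace) : (0 < #|{ffun pts a -> M}|)%N.
Proof. by rewrite card_ffun expn_gt0 cM0. Qed.

Lemma push_sel (r : S -> R) (k : 'I_2) :
  push (@Theta_map R M S w1 w2 (sel k)) (fun t => unif R t.1 * r t.2) =1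
  (fun t => unif R t.1 * r t.2).
Proof.
move=> t; transitivity (push (fun g : {ffun 'I_2 -> M} => [ffun i : 'I_1 => g k])
  (@unif R _) t.1 * r t.2).
  exact: (push_map_fst (fun g : {ffun 'I_2 -> M} => [ffun i : 'I_1 => g k])).
by rewrite push_unif_eval.
Qed.

(** By induction over the generated subcategory, so that coherence needs to be
    tested on the dispersion factors alone. *)
Lemma push_insertion (r : S -> R) a b (psi : pts a -> pts b) :
  insertion_gen psi ->
  push (@Theta_map R M S a b psi) (fun t => unif R t.1 * r t.2) =1
  (fun t => unif R t.1 * r t.2).
Proof.
elim=> {a b psi} [|a|a b c g f _ IHg _ IHf] t.
- exact: push_sel.
- rewrite /push (big_pred1 t)// => t' /=.
  by case: t' => h s; congr (_ == t); congr pair; apply/ffunP => i; rewrite ffunE.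
- have mapC z : Theta_map (g \o f) z = Theta_map f (Theta_map g z).
    by congr pair; apply/ffunP => i; rewrite !ffunE.
  rewrite -[RHS]IHf /push.
  rewrite (partition_big (Theta_map g) (fun t' => Theta_map f t' == t))/=; last first.
    by move=> z; rewrite mapC.
  apply: eq_bigr => t' /eqP tt'; rewrite -IHg /push.
  apply: eq_bigl => z; rewrite mapC.
  apply/andP/idP => [[]//|E]; split=> //; rewrite -tt'.
  by apply/eqP; congr (Theta_map f _); exact/eqP.
Qed.

Lemma coherent_prod_rule (r : cspace -> S -> R) :
  coherent (prod_rule r : weights_family M S) <-> (forall a b, r a =1 r b).
Proof.
split=> [coh|rE a b psi ins t]; last first.
  transitivity (unif R t.1 * r b t.2); first by rewrite /prod_rule (rE a b).
  exact/esym/(push_insertion (r b) ins).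
have r12 : r w1 =1 r w2.
  move=> s; have /card_gt0P[y _] := cM0.
  have := coh _ _ _ ig_insertion ([ffun=> y], s).
  rewrite (push_sel (r w2)) /prod_rule/=.
  by apply: mulfI; rewrite invr_neq0// pnatr_eq0 -lt0n cffun_gt0.
by case; case=> s //; rewrite r12.
Qed.
End CoherenceOfProductRules.

Section JeffreysScheme.
Context (R : realType) (M S : {fset R}).
Hypotheses (M0 : M != fset0) (S0 : S != fset0).
Hypothesis S_gt0 : forall s : S, 0 < val s.

Let cM0 : (0 < #|{: M}|)%N. Proof. exact: card_fset_gt0. Qed.
Let cffun_gt0 (a : cspace) : (0 < #|{ffun pts a -> M}|)%N.
Proof. by rewrite card_ffun expn_gt0 cM0. Qed.

Lemma weight_gt0 (e : R) (s : S) : 0 < weight e s.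
Proof. exact: powR_gt0. Qed.

Lemma sum_weight_gt0 (e : R) : 0 < \sum_(s : S) weight e s.
Proof.
have /card_gt0P[s _] := card_fset_gt0 S0.
rewrite (bigD1 s)//= ltr_pwDl ?weight_gt0// sumr_ge0// => t _.
by rewrite ltW ?weight_gt0.
Qed.

(** The law of the dispersion in a product rule with weight s^e. *)
Definition dispersion (e : R) : S -> R := normalise (weight e).

Lemma is_prob_dispersion (e : R) : is_prob (dispersion e).
Proof.
apply: is_prob_normalise; last exact: sum_weight_gt0.
by move=> s; rewrite ltW ?weight_gt0.
Qed.

Definition jeffreys_exp (a : cspace) : R := - ((csize a)%:R + 2) / 2.

Lemma finite_jeffreysE :
  finite_jeffreys M S = prod_rule (fun a => dispersion (jeffreys_exp a)).
Proof.
apply: functional_extensionality_dep => a; apply/funext => t.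
exact: (normalise_snd (weight (jeffreys_exp a)) t (cffun_gt0 a)).
Qed.

Lemma finite_indep_jeffreysE :
  finite_indep_jeffreys M S = prod_rule (fun=> dispersion (-1)).
Proof.
apply: functional_extensionality_dep => a; apply/funext => t.
exact: (normalise_snd (weight (- 1)) t (cffun_gt0 a)).
Qed.

Lemma is_prior_prod_rule (r : cspace -> S -> R) : (forall a, is_prob (r a)) ->
  is_prior (prod_rule r : weights_family M S).
Proof. by move=> r1 a; apply: is_prob_prod => //; exact: is_prob_unif. Qed.

Lemma marginal_jeffreys a :
  marginal (finite_jeffreys M S) a = dispersion (jeffreys_exp a).
Proof.
apply/funext => s; rewrite finite_jeffreysE.
exact/(push_snd (dispersion (jeffreys_exp a)))/sum_unif.
Qed.

Lemma defect_sel (r : cspace -> S -> R) k :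
  defect (prod_rule r : weights_family M S) (sel k) = tv (r w1) (r w2).
Proof.
rewrite /defect (funext (push_sel M0 (r w2) k)).
exact/(tv_prod (r w1))/is_prob_unif.
Qed.

Let m : R := #|` M|%:R.

(** What the merge does to the means. *)
Definition diagonal (g : {ffun 'I_1 -> M}) : {ffun 'I_2 -> M} :=
  [ffun i => g (wmerge i)].

Lemma diagonal_inj : injective diagonal.
Proof.
move=> g g' /ffunP/(_ ord0); rewrite !ffunE => E; apply/ffunP => i.
by rewrite ord1.
Qed.

Let m_gt0 : 0 < m. Proof. by rewrite ltr0n cardfs_gt0. Qed.

Let ratioE : #|{ffun 'I_1 -> M}|%:R / #|{ffun 'I_2 -> M}|%:R = m^-1 :> R.
Proof.
rewrite !card_ffun !card_ord -cardfE expn1 natrX -/m.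
by field; rewrite gt_eqF.
Qed.

Lemma defect_merge (r : cspace -> S -> R) : (forall a, is_prob (r a)) ->
  defect (prod_rule r : weights_family M S) wmerge =
  2^-1 * ((1 - m^-1) + \sum_(s : S) `|m^-1 * r w2 s - r w1 s|).
Proof.
move=> r1; have [r20 r21] := r1 w2.
rewrite -ratioE.
exact: (tv_unif_push_inj diagonal_inj (cffun_gt0 w1) (cffun_gt0 w2) (r w1) r20 r21).
Qed.

Lemma mass_outside_diagonal (r : cspace -> S -> R) : (forall a, is_prob (r a)) ->
  \sum_(t : Theta M S w2 | t \notin codom (@Theta_map R M S w2 w1 wmerge))
    prod_rule r w2 t = 1 - m^-1.
Proof.
move=> r1; have [r20 r21] := r1 w2.
rewrite -ratioE.
exact: (unif_mass_outside diagonal_inj (cffun_gt0 w2) r21).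
Qed.

End JeffreysScheme.

(** In terms of the standard deviations d the two dispersion laws are
    d^-3 / Z1 and d^-4 / Z2. *)
Section JeffreysDispersions.
Context (R : realType) (S : {fset R}).
Hypotheses (S0 : S != fset0) (S_gt0 : forall s : S, 0 < val s).

Let d (s : S) : R := val s `^ (1 / 2).
Let d_gt0 s : 0 < d s. Proof. exact: powR_gt0. Qed.
Let Z1 : R := Zsum S 1.
Let Z2 : R := Zsum S 2.
Let Z1_gt0 : 0 < Z1. Proof. exact: sum_weight_gt0. Qed.
Let Z2_gt0 : 0 < Z2. Proof. exact: sum_weight_gt0. Qed.

Let weight_half (n : nat) s : weight (- (n%:R + 2) / 2) s = d s ^- (n + 2).
Proof.
rewrite /weight /d (_ : - (n%:R + 2) / 2 = 1 / 2 * - (n + 2)%:R :> R).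
  by rewrite powRrM powR_invn// ltW// d_gt0.
by rewrite natrD; field.
Qed.

Let dispersion1 s : dispersion (jeffreys_exp R w1) s = d s ^- 3 / Z1.
Proof. by rewrite -(weight_half 1). Qed.

Let dispersion2 s : dispersion (jeffreys_exp R w2) s = d s ^- 4 / Z2.
Proof. by rewrite -(weight_half 2). Qed.

(** Equality of the two laws forces d = Z1 / Z2 for every element of S. *)
Lemma dispersions_neq : (1 < #|` S|)%N ->
  ~ dispersion (jeffreys_exp R w1) =1 dispersion (jeffreys_exp R w2) :> (S -> R).
Proof.
move=> S1 E.
have dE s : d s = Z1 / Z2.
  have dn0 : d s != 0 by rewrite gt_eqF.
  have Z1n0 : Z1 != 0 by rewrite gt_eqF.
  have Z2n0 : Z2 != 0 by rewrite gt_eqF.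
  have := E s; rewrite dispersion1 dispersion2 => /(congr1 ( *%R (d s ^+ 4 * Z1))).
  have -> : d s ^+ 4 * Z1 * (d s ^- 3 / Z1) = d s by field; rewrite Z1n0 ?dn0.
  by move=> ->; field; rewrite Z2n0 ?dn0.
have : (#|` S| <= 1)%N.
  rewrite cardfE; apply/fintype_le1P => s t.
  apply/val_inj/(@powR_injective R (1 / 2)); rewrite ?divr_gt0 ?nnegrE ?(ltW (S_gt0 _))//.
  by rewrite -/(d s) -/(d t) !dE.
by rewrite leqNgt S1.
Qed.

Variable m : R.
Hypothesis m_gt0 : 0 < m.

(** Multiply by m d^4 Z1. *)
Lemma dispersion_le s :
  m^-1 * dispersion (jeffreys_exp R w2) s <= dispersion (jeffreys_exp R w1) s <->
  Z1 / Z2 <= m * d s.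
Proof.
rewrite dispersion1 dispersion2 ler_pdivlMr// -subr_ge0 -[Z1 / Z2 <= _]subr_ge0.
have -> : d s ^- 3 - m^-1 * (d s ^- 4 / Z2) * Z1 =
    (m * d s - Z1 / Z2) * (m^-1 * d s ^- 4).
  by field; rewrite !gt_eqF.
by rewrite pmulr_lge0// mulr_gt0 ?invr_gt0 ?exprn_gt0.
Qed.

Lemma dispersion_le_min smin : is_fmin S smin ->
  (forall s : S, m^-1 * dispersion (jeffreys_exp R w2) s <=
    dispersion (jeffreys_exp R w1) s) <->
  Z1 / Z2 <= m * smin `^ (1 / 2).
Proof.
move=> [sminS smin_le]; split=> [H|H s].
  exact: (dispersion_le [` sminS]).1.
apply/dispersion_le/(le_trans H); rewrite ler_pM2l//.
apply: ge0_ler_powR; rewrite ?divr_ge0 ?nnegrE//.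
- exact: ltW (S_gt0 [` sminS]).
- exact/ltW/S_gt0.
- exact: smin_le (valP s).
Qed.

(** With w = a / d t, a^3 (2 a / d^4 - 1 / d^3) = 2 w^4 - w^3 is at least
    -27/2048, its minimum at w = 3/8, and it is 1 at t = s.  At most 75 other
    terms cannot outweigh this 1. *)
Lemma dispersion_le_small : 2 <= m -> (#|` S| <= 76)%N ->
  forall s : S, m^-1 * dispersion (jeffreys_exp R w2) s <= dispersion (jeffreys_exp R w1) s.
Proof.
move=> m2 S76 s; apply/dispersion_le.
set a := d s; have a0 : 0 < a by exact: d_gt0.
have an0 : a != 0 by rewrite gt_eqF.
apply: (@le_trans _ _ (2 * a)); last by rewrite ler_pM2r.
rewrite ler_pdivrMr// -subr_ge0.
have -> : 2 * a * Z2 - Z1 = \sum_t (2 * a * d t ^- 4 - d t ^- 3).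
  rewrite big_split/= sumrN -mulr_sumr; congr (_ * _ - _).
    by apply: eq_bigr => t _; exact: (weight_half 2).
  by apply: eq_bigr => t _; exact: (weight_half 1).
rewrite (bigD1 s)//= -/a.
have -> : 2 * a * a ^- 4 - a ^- 3 = a ^- 3 by field.
have term t : - (27 / 2048) * a ^- 3 <= 2 * a * d t ^- 4 - d t ^- 3.
  have dn0 : d t != 0 by rewrite gt_eqF.
  pose w := a / d t.
  rewrite -subr_ge0.
  (* The double root at w = 3/8 is the minimum. *)
  have -> : 2 * a * d t ^- 4 - d t ^- 3 - - (27 / 2048) * a ^- 3 =
    2 * (w - 3 / 8) ^+ 2 * ((w + 1 / 8) ^+ 2 + 1 / 32) * a ^- 3.
    by rewrite /w; field; rewrite an0 dn0.
  rewrite mulr_ge0 ?invr_ge0 ?exprn_ge0 ?(ltW a0)// mulr_ge0//.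
    by rewrite mulr_ge0// sqr_ge0.
  by rewrite addr_ge0// sqr_ge0.
apply: (@le_trans _ _ (a ^- 3 + \sum_(t | t != s) - (27 / 2048) * a ^- 3)); last first.
  by rewrite lerD2l; apply: ler_sum => t _; exact: term.
rewrite sumr_const -[X in _ + X]mulr_natl.
have : (#|[pred t | t != s]| <= 75)%N.
  have := cardC1 s; rewrite -cardfE => E; rewrite (leq_trans _ (_ : #|` S|.-1 <= 75)%N)//.
    by rewrite -E; apply: eq_leq; apply: eq_card.
  by case: #|` S| S76.
set k := #|_| => k75.
have : k%:R <= 75 :> R by rewrite ler_nat.
have : 0 < a ^- 3 by rewrite invr_gt0 exprn_gt0.
set A := a ^- 3 => A0 k75'.
nra.
Qed.

End JeffreysDispersions.

(** The triangle inequality: the differences r' - q r have sum 1 - q. *)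
Lemma merge_defect_ge (R : realType) (S : finType) (q : R) (r r' : S -> R) :
  is_prob r -> is_prob r' ->
  1 - q <= 2^-1 * ((1 - q) + \sum_s `|q * r s - r' s|).
Proof.
move=> [_ r1] [_ r'1].
have : \sum_s (r' s - q * r s) <= \sum_s `|q * r s - r' s|.
  by apply: ler_sum => s _; rewrite distrC ler_norm.
rewrite big_split/= sumrN -mulr_sumr r1 r'1 mulr1 => H.
by rewrite mulrC ler_pdivlMr//; lra.
Qed.

Lemma merge_defect_eq (R : realType) (S : finType) (q : R) (r r' : S -> R) :
  is_prob r -> is_prob r' ->
  2^-1 * ((1 - q) + \sum_s `|q * r s - r' s|) = 1 - q <->
  forall s, q * r s <= r' s.
Proof.
move=> [_ r1] [_ r'1].
have E : \sum_s (r' s - q * r s) = 1 - q.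
  by rewrite big_split/= sumrN -mulr_sumr r1 r'1 mulr1.
have -> : (forall s, q * r s <= r' s) <-> (forall s, 0 <= r' s - q * r s).
  by split=> H s; have := H s; rewrite subr_ge0.
rewrite -sum_norm_eq E; under eq_bigr do rewrite distrC.
split=> H; first by lra.
by rewrite H; field.
Qed.

(** * Sums of inverse powers and the numerical examples *)

Section InversePowerSums.
Variable R : realType.

Lemma sum_le_telescope (f G : nat -> R) (a b : nat) : (a <= b)%N ->
  (forall k, (a <= k)%N -> f k <= G k - G k.+1) ->
  \sum_(a <= k < b) f k <= G a - G b.
Proof.
move=> ab fG; rewrite -opprB -(telescope_sumr _ ab) -sumrN.
by rewrite !big_nat; apply: ler_sum => k /andP[ak _]; rewrite opprB fG.
Qed.

Lemma sum_ge_telescope (f G : nat -> R) (a b : nat) : (a <= b)%N ->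
  (forall k, (a <= k)%N -> G k - G k.+1 <= f k) ->
  G a - G b <= \sum_(a <= k < b) f k.
Proof.
move=> ab fG; rewrite -opprB -(telescope_sumr _ ab) -sumrN.
by rewrite !big_nat; apply: ler_sum => k /andP[ak _]; rewrite opprB fG.
Qed.

(** By convexity k^-3 is at most the integral of x^-3 from k - 1/2 to k + 1/2. *)
Lemma sum_inv_cube_le (a b : nat) : (0 < a)%N -> (a <= b)%N ->
  \sum_(a <= k < b) (k%:R : R) ^- 3 <=
  (2 * (a%:R - 1 / 2) ^+ 2)^-1 - (2 * (b%:R - 1 / 2) ^+ 2)^-1.
Proof.
move=> a0 ab; apply: (sum_le_telescope (G := fun k => (2 * (k%:R - 1 / 2) ^+ 2)^-1)) => //.
move=> k ak; rewrite -[k.+1%:R]natr1; set x : R := k%:R.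
have x1 : 1 <= x by rewrite ler1n (leq_trans a0).
rewrite -subr_ge0.
have -> : (2 * (x - 1 / 2) ^+ 2)^-1 - (2 * (x + 1 - 1 / 2) ^+ 2)^-1 - x ^- 3 =
    (x ^+ 2 / 2 - 1 / 16) / (((x - 1 / 2) * (x + 1 / 2)) ^+ 2 * x ^+ 3).
  field; apply/and3P; split; rewrite gt_eqF//; lra.
apply: divr_ge0; first by nra.
by rewrite mulr_ge0 ?sqr_ge0// exprn_ge0//; lra.
Qed.

(** The shift 1/4 turns the telescoping difference into k / (k^4 + 1/4), just
    below k^-3. *)
Lemma sum_inv_cube_ge (a b : nat) : (0 < a)%N -> (a <= b)%N ->
  (2 * ((a%:R - 1 / 2) ^+ 2 + 1 / 4))^-1 - (2 * ((b%:R - 1 / 2) ^+ 2 + 1 / 4))^-1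
  <= \sum_(a <= k < b) (k%:R : R) ^- 3.
Proof.
move=> a0 ab.
apply: (sum_ge_telescope (G := fun k => (2 * ((k%:R - 1 / 2) ^+ 2 + 1 / 4))^-1)) => //.
move=> k ak; rewrite -[k.+1%:R]natr1; set x : R := k%:R.
have x1 : 1 <= x by rewrite ler1n (leq_trans a0).
rewrite -subr_ge0.
have p1 : 0 < (x - 1 / 2) ^+ 2 + 1 / 4 by rewrite ltr_wpDl ?sqr_ge0//; lra.
have p2 : 0 < (x + 1 - 1 / 2) ^+ 2 + 1 / 4 by rewrite ltr_wpDl ?sqr_ge0//; lra.
have x3 : 0 < x ^+ 3 by rewrite exprn_gt0//; lra.
have -> : x ^- 3 - ((2 * ((x - 1 / 2) ^+ 2 + 1 / 4))^-1 -
    (2 * ((x + 1 - 1 / 2) ^+ 2 + 1 / 4))^-1) =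
    4^-1 / (x ^+ 3 * ((x - 1 / 2) ^+ 2 + 1 / 4) * ((x + 1 - 1 / 2) ^+ 2 + 1 / 4)).
  field; rewrite !gt_eqF//; lra.
by rewrite divr_ge0// !mulr_ge0// ltW.
Qed.

(** By convexity k^-4 is at most the integral of x^-4 from k - 1/2 to k + 1/2. *)
Lemma sum_inv_fourth_le (a b : nat) : (0 < a)%N -> (a <= b)%N ->
  \sum_(a <= k < b) (k%:R : R) ^- 4 <=
  (3 * (a%:R - 1 / 2) ^+ 3)^-1 - (3 * (b%:R - 1 / 2) ^+ 3)^-1.
Proof.
move=> a0 ab; apply: (sum_le_telescope (G := fun k => (3 * (k%:R - 1 / 2) ^+ 3)^-1)) => //.
move=> k ak; rewrite -[k.+1%:R]natr1; set x : R := k%:R.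
have x1 : 1 <= x by rewrite ler1n (leq_trans a0).
rewrite -subr_ge0.
have -> : (3 * (x - 1 / 2) ^+ 3)^-1 - (3 * (x + 1 - 1 / 2) ^+ 3)^-1 - x ^- 4 =
    (5 / 6 * x ^+ 4 - 3 / 16 * x ^+ 2 + 1 / 64) /
    (((x - 1 / 2) * (x + 1 / 2)) ^+ 3 * x ^+ 4).
  field; apply/and3P; split; rewrite gt_eqF//; lra.
apply: divr_ge0.
  have x2 : 1 <= x ^+ 2 by exact: exprn_ege1.
  have x24 : x ^+ 2 <= x ^+ 4 by exact: ler_weXn2l.
  lra.
by rewrite mulr_ge0// exprn_ge0//; nra.
Qed.

(** The shift 1/2 cancels the terms of order k^4 in the difference, which leaves
    a quadratic numerator of the right sign. *)
Lemma sum_inv_fourth_ge (a b : nat) : (0 < a)%N -> (a <= b)%N ->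
  (3 * (a%:R - 1 / 2) * ((a%:R - 1 / 2) ^+ 2 + 1 / 2))^-1 -
  (3 * (b%:R - 1 / 2) * ((b%:R - 1 / 2) ^+ 2 + 1 / 2))^-1
  <= \sum_(a <= k < b) (k%:R : R) ^- 4.
Proof.
move=> a0 ab.
apply: (sum_ge_telescope
  (G := fun k => (3 * (k%:R - 1 / 2) * ((k%:R - 1 / 2) ^+ 2 + 1 / 2))^-1)) => //.
move=> k ak; rewrite -[k.+1%:R]natr1; set x : R := k%:R.
have x1 : 1 <= x by rewrite ler1n (leq_trans a0).
rewrite -subr_ge0.
have p1 : 0 < (x - 1 / 2) ^+ 2 + 1 / 2 by rewrite ltr_wpDl ?sqr_ge0//; lra.
have p2 : 0 < (x + 1 - 1 / 2) ^+ 2 + 1 / 2 by rewrite ltr_wpDl ?sqr_ge0//; lra.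
have q1 : 0 < x - 1 / 2 by lra.
have q2 : 0 < x + 1 - 1 / 2 by lra.
have x4 : 0 < x ^+ 4 by rewrite exprn_gt0//; lra.
have -> : x ^- 4 - ((3 * (x - 1 / 2) * ((x - 1 / 2) ^+ 2 + 1 / 2))^-1 -
    (3 * (x + 1 - 1 / 2) * ((x + 1 - 1 / 2) ^+ 2 + 1 / 2))^-1) =
    (7 / 16 * x ^+ 2 - 9 / 64) / (x ^+ 4 * (x - 1 / 2) * (x + 1 - 1 / 2) *
      ((x - 1 / 2) ^+ 2 + 1 / 2) * ((x + 1 - 1 / 2) ^+ 2 + 1 / 2)).
  field; rewrite !gt_eqF//; lra.
rewrite divr_ge0//; first by nra.
by rewrite !mulr_ge0// ltW.
Qed.

(** Clearing denominators turns the telescoping bounds into inequalities that are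
    linear in the sum s. *)
Lemma invB_le (u v s : R) : 0 < u -> 0 < v ->
  (u^-1 - v^-1 <= s) = (v - u <= s * (u * v)).
Proof.
move=> u0 v0; rewrite -ler_pdivrMr ?mulr_gt0//; congr (_ <= _).
by field; rewrite !gt_eqF.
Qed.

Lemma le_invB (u v s : R) : 0 < u -> 0 < v ->
  (s <= u^-1 - v^-1) = (s * (u * v) <= v - u).
Proof.
move=> u0 v0; rewrite -ler_pdivlMr ?mulr_gt0//; congr (_ <= _).
by field; rewrite !gt_eqF.
Qed.

Lemma sum_inv_cube_bounds :
  36 + 73 / 250 <= \sum_(105 <= k < 230) ((k%:R / 100 : R)) ^- 3 <= 36 + 147 / 500.
Proof.
under eq_bigr do rewrite expr_div_n invf_div mulrC.
rewrite -mulr_suml.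
have := sum_inv_cube_le (a := 105) (b := 230) isT isT.
have := sum_inv_cube_ge (a := 105) (b := 230) isT isT.
move: (\sum_(_ <= _ < _) _) => s.
rewrite invB_le; [|lra|lra]; rewrite le_invB; [|lra|lra].
lra.
Qed.

Lemma sum_inv_fourth_bounds :
  26 + 9 / 20 <= \sum_(105 <= k < 230) ((k%:R / 100 : R)) ^- 4 <= 26 + 227 / 500.
Proof.
under eq_bigr do rewrite expr_div_n invf_div mulrC.
rewrite -mulr_suml.
have := sum_inv_fourth_le (a := 105) (b := 230) isT isT.
have := sum_inv_fourth_ge (a := 105) (b := 230) isT isT.
move: (\sum_(_ <= _ < _) _) => s.
rewrite invB_le; [|lra|lra]; rewrite le_invB; [|lra|lra].
lra.
Qed.
End InversePowerSums.

Section Examples.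
Variable R : realType.

Lemma sum_fset_mem (K : {fset R}) (l : seq R) (F : R -> R) :
  uniq l -> K =i l -> \sum_(s : K) F (val s) = \sum_(z <- l) F z.
Proof.
move=> ul Kl; rewrite -(big_seq_fsetE _ K xpredT F)/=.
by apply/perm_big/uniq_perm => //; exact: fset_uniq.
Qed.

Lemma dispersion_val (S : {fset R}) (l : seq R) (e : R) (s : S) :
  uniq l -> S =i l ->
  dispersion e s = val s `^ e / \sum_(z <- l) z `^ e.
Proof. by move=> ul Sl; rewrite -(sum_fset_mem _ ul Sl). Qed.

(** The dispersions of the examples are squares of known standard deviations. *)
Lemma powR_sqr (t : R) (n : nat) : 0 <= t -> (t ^+ 2) `^ (- n%:R / 2) = t ^- n.
Proof.
move=> t0; rewrite -powR_mulrn// -powRrM (_ : 2 * _ = - n%:R); last by field.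
by rewrite powR_invn.
Qed.

Lemma jeffreys_exp1 : jeffreys_exp R w1 = - 3%:R / 2.
Proof. by rewrite /jeffreys_exp/=; congr (- _ / _); ring. Qed.

Lemma jeffreys_exp2 : jeffreys_exp R w2 = - 4%:R / 2.
Proof. by rewrite /jeffreys_exp/=; congr (- _ / _); ring. Qed.

Section TwoByTwo.
Let M : {fset R} := [fset 0; 1].
Let S : {fset R} := [fset 1; 4].

Let l : seq R := [:: 1 ^+ 2; 2 ^+ 2].

Let ul : uniq l.
Proof. by rewrite /= inE andbT lt_eqF//; lra. Qed.

Let Sl : S =i l.
Proof. by move=> z; rewrite !inE expr1n (_ : 4 = 2 ^+ 2)//; ring. Qed.

Let S_gt0 (s : S) : 0 < val s.
Proof.
have : val s \in l by rewrite -Sl; exact: valP.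
by rewrite !inE => /orP[] /eqP ->; lra.
Qed.

Let M0 : M != fset0.
Proof. by apply/fset0Pn; exists 0; rewrite !inE eqxx. Qed.

Let S0 : S != fset0.
Proof. by apply/fset0Pn; exists 1; rewrite !inE eqxx. Qed.

Let cM : #|` M| = 2%N.
Proof. by rewrite cardfs2 eq_sym oner_eq0. Qed.

Let cS : #|` S| = 2%N.
Proof. by rewrite cardfs2 lt_eqF//; lra. Qed.

Let disp (t : R) (s : S) : 0 <= t -> val s = t ^+ 2 ->
  dispersion (jeffreys_exp R w1) s = t ^- 3 / (9 / 8) /\
  dispersion (jeffreys_exp R w2) s = t ^- 4 / (17 / 16).
Proof.
move=> t0 st; rewrite !(dispersion_val _ _ ul Sl) jeffreys_exp1 jeffreys_exp2 st.
rewrite !big_cons !big_nil !powR_sqr//.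
split; congr (_ / _); by field.
Qed.

Lemma example_marginal1 (s : S) : val s = 1 ->
  marginal (finite_jeffreys M S) w1 s = 8 / 9 /\
  marginal (finite_jeffreys M S) w2 s = 16 / 17.
Proof.
move=> s1; rewrite !marginal_jeffreys//.
have [||-> ->] := @disp 1 s; rewrite ?expr1n//.
by split; field.
Qed.

Lemma example_marginal4 (s : S) : val s = 4 ->
  marginal (finite_jeffreys M S) w1 s = 1 / 9 /\
  marginal (finite_jeffreys M S) w2 s = 1 / 17.
Proof.
move=> s4; rewrite !marginal_jeffreys//.
have [||-> ->] := @disp 2 s => //; first by rewrite s4; ring.
by split; field.
Qed.

Lemma example_defect_sel k : defect (finite_jeffreys M S) (sel k) = 8 / 153.
Proof.
rewrite finite_jeffreysE// defect_sel// /tv.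
under eq_bigr do rewrite !(dispersion_val _ _ ul Sl).
rewrite (sum_fset_mem (fun z =>
  `|z `^ jeffreys_exp R w1 / _ - z `^ jeffreys_exp R w2 / _|) ul Sl).
rewrite !big_cons !big_nil jeffreys_exp1 jeffreys_exp2 !powR_sqr// !expr1n.
have -> : 1^-1 / (1^-1 + (2 ^- 3 + 0)) - 1^-1 / (1^-1 + (2 ^- 4 + 0)) = - (8 / 153) :> R.
  by field.
have -> : 2 ^- 3 / (1^-1 + (2 ^- 3 + 0)) - 2 ^- 4 / (1^-1 + (2 ^- 4 + 0)) = 8 / 153 :> R.
  by field.
by rewrite normrN ger0_norm; [field|lra].
Qed.

Lemma example_defect_merge : defect (finite_jeffreys M S) wmerge = 1 / 2.
Proof.
rewrite finite_jeffreysE// defect_merge//; last by move=> a; exact: is_prob_dispersion.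
rewrite cM (merge_defect_eq _ (is_prob_dispersion _ _ _) (is_prob_dispersion _ _ _)).2//.
  by field.
by apply: dispersion_le_small => //; rewrite cS.
Qed.

End TwoByTwo.
End Examples.

Section StrictMergeDefect.
Variables (R : realType) (M : {fset R}).
Hypothesis cM : #|` M| = 2%N.

Let l : seq R := 4^-1 :: [seq (k%:R / 100) ^+ 2 | k <- iota 105 125].
Let S : {fset R} := [fset s in
     4^-1 :: [seq (k%:R / 100) ^+ 2 | k <- iota 105 125]].

Let Sl : S =i l.
Proof. by move=> z; rewrite in_fset. Qed.

Let iotaP k : (k \in iota 105 125) -> 1 <= k%:R / 100 :> R.
Proof.
rewrite mem_iota => /andP[k105 _].
by rewrite ler_pdivlMr// mul1r ler_nat (leq_trans _ k105).
Qed.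

Let ul : uniq l.
Proof.
rewrite cons_uniq map_inj_in_uniq ?iota_uniq ?andbT.
  apply/mapP => -[k /iotaP k1 E].
  by have : 1 <= 4^-1 :> R; [rewrite E exprn_ege1|lra].
move=> j k _ _ /eqP; rewrite eqrXn2 ?divr_ge0// => /eqP /mulIf E.
by apply/eqP; rewrite -(eqr_nat R); apply/eqP/E.
Qed.

Let S_gt0 (s : S) : 0 < val s.
Proof.
have : val s \in l by rewrite -Sl; exact: valP.
rewrite inE => /predU1P[->|/mapP[k /iotaP k1 ->]]; first by rewrite invr_gt0.
by rewrite exprn_gt0// (lt_le_trans _ k1).
Qed.

Let M0 : M != fset0. Proof. by rewrite -cardfs_gt0 cM. Qed.

Let S0 : S != fset0.
Proof. by apply/fset0Pn; exists 4^-1; rewrite Sl mem_head. Qed.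

Let A1 : R := \sum_(105 <= k < 230) (k%:R / 100) ^- 3.
Let A2 : R := \sum_(105 <= k < 230) (k%:R / 100) ^- 4.

Let sum_l (F : R -> R) : \sum_(z <- l) F z =
  F ((2^-1) ^+ 2) + \sum_(105 <= k < 230) F ((k%:R / 100) ^+ 2).
Proof. by rewrite big_cons big_map exprVn; congr (F _^-1 + _); ring. Qed.

Let Z1E : \sum_(z <- l) z `^ jeffreys_exp R w1 = 8 + A1.
Proof.
rewrite sum_l jeffreys_exp1 powR_sqr//; congr (_ + _); first by field.
by apply: eq_bigr => k _; rewrite powR_sqr// divr_ge0.
Qed.

Let Z2E : \sum_(z <- l) z `^ jeffreys_exp R w2 = 16 + A2.
Proof.
rewrite sum_l jeffreys_exp2 powR_sqr//; congr (_ + _); first by field.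
by apply: eq_bigr => k _; rewrite powR_sqr// divr_ge0.
Qed.

(** At s = 1/4 the standard deviation 1/2 is below Z1 / (2 Z2), so that rho_2 / 2
    exceeds rho_1 there; at all others it is above.  The other terms add up to
    (1 - 8 / Z1) - (1 - 16 / Z2) / 2. *)
Lemma defect_merge_strict :
  defect (finite_jeffreys M S) wmerge = 1 / 2 + 8 / (16 + A2) - 8 / (8 + A1).
Proof.
have /andP[A1l A1u] := sum_inv_cube_bounds R.
have /andP[A2l A2u] := sum_inv_fourth_bounds R.
rewrite -/A1 -/A2 in A1l A1u A2l A2u.
rewrite finite_jeffreysE// defect_merge//; last by move=> a; exact: is_prob_dispersion.
rewrite cM; under eq_bigr do rewrite !(dispersion_val _ _ ul Sl).
rewrite (sum_fset_mem (fun z =>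
  `|_ * (z `^ jeffreys_exp R w2 / _) - z `^ jeffreys_exp R w1 / _|) ul Sl).
rewrite Z1E Z2E sum_l jeffreys_exp1 jeffreys_exp2 !powR_sqr//.
have Z1_gt0 : 0 < 8 + A1 by lra.
have Z2_gt0 : 0 < 16 + A2 by lra.
have -> : \sum_(105 <= k < 230) `|2^-1 * (((k%:R / 100) ^+ 2) `^ (- 4%:R / 2) / (16 + A2)) -
    ((k%:R / 100) ^+ 2) `^ (- 3%:R / 2) / (8 + A1)| =
    A1 / (8 + A1) - 2^-1 * (A2 / (16 + A2)).
  transitivity (\sum_(105 <= k < 230) ((k%:R / 100) ^- 3 / (8 + A1) -
      2^-1 * ((k%:R / 100) ^- 4 / (16 + A2)))); last first.
    by rewrite sumrB -mulr_suml -mulr_sumr -mulr_suml.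
  apply: eq_big_nat => k /andP[k105 k230].
  have t1 : 1 <= k%:R / 100 :> R by apply: iotaP; rewrite mem_iota k105.
  move: (k%:R / 100) t1 => t t1; have t0 : 0 < t by lra.
  rewrite !powR_sqr ?(ltW t0)// distrC ger0_norm// subr_ge0.
  rewrite ler_pdivlMr// -subr_ge0.
  have -> : t ^- 3 - 2^-1 * (t ^- 4 / (16 + A2)) * (8 + A1) =
      (2 * (16 + A2) * t - (8 + A1)) * (2^-1 * t ^- 4 / (16 + A2)).
    by field; rewrite !gt_eqF.
  rewrite mulr_ge0//; first by nra.
  by rewrite divr_ge0 ?(ltW Z2_gt0)// mulr_ge0// invr_ge0 exprn_ge0// ltW.
have -> : 2^-1 * (2^-1 ^- 4 / (16 + A2)) - 2^-1 ^- 3 / (8 + A1) =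
    8 / (16 + A2) - 8 / (8 + A1) by field; rewrite !gt_eqF.
rewrite ger0_norm; last first.
  rewrite subr_ge0 ler_pM2l// lef_pV2 ?posrE//; lra.
by field; rewrite !gt_eqF.
Qed.

Lemma defect_merge_bounds :
  5078 / 10000 <= defect (finite_jeffreys M S) wmerge < 5079 / 10000.
Proof.
rewrite defect_merge_strict.
have /andP[A1l A1u] := sum_inv_cube_bounds R.
have /andP[A2l A2u] := sum_inv_fourth_bounds R.
rewrite -/A1 -/A2 in A1l A1u A2l A2u.
have Z1_gt0 : 0 < 8 + A1 by lra.
have Z2_gt0 : 0 < 16 + A2 by lra.
have E1 : (8 + A1)^-1 * (8 + A1) = 1 by rewrite mulVf// gt_eqF.
have E2 : (16 + A2)^-1 * (16 + A2) = 1 by rewrite mulVf// gt_eqF.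
have i1_gt0 : 0 < (8 + A1)^-1 by rewrite invr_gt0.
have i2_gt0 : 0 < (16 + A2)^-1 by rewrite invr_gt0.
move: (8 + A1)^-1 (16 + A2)^-1 E1 E2 i1_gt0 i2_gt0 => i1 i2 E1 E2 i1_gt0 i2_gt0.
have := ler_wpM2l (ltW i1_gt0) A1l; have := ler_wpM2l (ltW i1_gt0) A1u.
have := ler_wpM2l (ltW i2_gt0) A2l; have := ler_wpM2l (ltW i2_gt0) A2u.
move=> h1 h2 h3 h4.
by apply/andP; split; lra.
Qed.

End StrictMergeDefect.

(** * The theorem *)

Theorem proposition8p5 (R : realType) :
  (forall (w u : finType) (x : u -> w)
      (d : measure_display) (Omega : measurableType d)
      (P : (w -> R) -> R -> probability Omega R)
      (Y : u -> {mfun Omega >-> R}),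
    (0 < #|w|)%N -> (forall a : w, exists i : u, x i = a) ->
    gaussian_layout x P Y ->
    [/\ forall mu v, 0 < v -> fisher x P Y mu v \in unitmx,
        forall e : R, propto_power (jeffreys x P Y) e <->
          e = - (#|w|%:R + 2) / 2 &
        forall (mu0 : w -> R) (v0 : R), 0 < v0 ->
          forall e : R, propto_power (indep_jeffreys x P Y mu0 v0) e <->
          e = - 1])
  /\
  (forall M S : {fset R}, M != fset0 -> S != fset0 -> rat_squares S ->
    let piJ := finite_jeffreys M S in
    let piIJ := finite_indep_jeffreys M S in
    let rho := marginal piJ in
    let m : R := #|` M|%:R in
    [/\ is_prior piJ /\ is_prior piIJ,
        (* (1) *)
        [/\ forall r : cspace -> S -> R, (forall a, is_prob (r a)) ->
              coherent (prod_rule r : weights_family M S) <-> (forall a b, r a =1 r b),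
            coherent piIJ &
            (1 < #|` S|)%N -> ~ coherent piJ],
        (* (2), selections *)
        [/\ forall a, piJ a =1 prod_rule rho a,
            forall k : 'I_2, push (Theta_map (sel k)) (piJ w2) =1
              (fun t => unif R t.1 * rho w2 t.2),
            forall k : 'I_2, defect piJ (sel k) = tv (rho w1) (rho w2),
            forall k : 'I_2, defect piJ (sel k) =
              tv (normalise (@weight R S (- 3 / 2)))
                 (normalise (@weight R S (- 2))) &
            forall (M' : {fset R}) (k : 'I_2), M' != fset0 ->
              defect (finite_jeffreys M' S) (sel k) = defect piJ (sel k)] &
        (* (2), merge *)
        [/\ defect piJ wmerge =
              2^-1 * ((1 - m^-1) + \sum_(s : S) `|m^-1 * rho w2 s - rho w1 s|)
            /\ 1 - m^-1 <= defect piJ wmerge,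
            \sum_(t : Theta M S w2 | t \notin codom (@Theta_map R M S w2 w1 wmerge))
              piJ w2 t = 1 - m^-1,
            defect piJ wmerge = 1 - m^-1 <->
              (forall s : S, m^-1 * rho w2 s <= rho w1 s),
            forall smin : R, is_fmin S smin ->
              (defect piJ wmerge = 1 - m^-1 <->
                Zsum S 1 / Zsum S 2 <= m * smin `^ (1 / 2)) &
            (1 < #|` M|)%N -> (#|` S| <= 76)%N ->
              defect piJ wmerge = 1 - m^-1]])
  /\
  (let M : {fset R} := [fset 0; 1] in
   let S : {fset R} := [fset 1; 4] in
   let piJ := finite_jeffreys M S in
   [/\ forall s : S, val s = 1 ->
         marginal piJ w1 s = 8 / 9 /\ marginal piJ w2 s = 16 / 17,
       forall s : S, val s = 4 ->
         marginal piJ w1 s = 1 / 9 /\ marginal piJ w2 s = 1 / 17,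
       forall k : 'I_2, defect piJ (sel k) = 8 / 153 &
       defect piJ wmerge = 1 / 2])
  /\
  (forall M : {fset R}, #|` M| = 2%N ->
   let S : {fset R} := [fset s in
     4^-1 :: [seq (k%:R / 100) ^+ 2 | k <- iota 105 125]] in
   5078 / 10000 <= defect (finite_jeffreys M S) wmerge < 5079 / 10000).
Proof.
split; last split; last split.
- move=> w u x d Omega P Y w_gt0 x_surj layout; split.
  + by move=> mu v v0; exact: fisher_unit.
  + by move=> e; exact: jeffreys_propto.
  + by move=> mu0 v0 v0_gt0 e; exact: indep_jeffreys_propto.
- move=> M S M0 S0 Ssq piJ piIJ rho m.
  have S_gt0 (s : S) : 0 < val s.
    by have [q q0 ->] := Ssq _ (valP s); rewrite exprn_even_gt0//= fmorph_eq0.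
  have pJ a : is_prob (dispersion (jeffreys_exp R a) : S -> R).
    exact: is_prob_dispersion.
  have piJE : piJ = prod_rule (fun a => dispersion (jeffreys_exp R a)).
    exact: finite_jeffreysE.
  have piIJE : piIJ = prod_rule (fun=> dispersion (- 1)).
    exact: finite_indep_jeffreysE.
  have rhoE : rho = (fun a => dispersion (jeffreys_exp R a)).
    by apply/funext => a; exact: marginal_jeffreys.
  have m_gt0 : 0 < m by rewrite ltr0n cardfs_gt0.
  have mergeE : defect piJ wmerge =
      2^-1 * ((1 - m^-1) + \sum_(s : S) `|m^-1 * rho w2 s - rho w1 s|).
    by rewrite piJE rhoE; exact: defect_merge.
  have merge_min : defect piJ wmerge = 1 - m^-1 <->
      (forall s : S, m^-1 * rho w2 s <= rho w1 s).
    by rewrite mergeE rhoE; exact: merge_defect_eq.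
  split.
  + split; rewrite ?piJE ?piIJE; apply: is_prior_prod_rule => // a.
    exact: is_prob_dispersion.
  + split.
    * by move=> r _; exact: coherent_prod_rule.
    * by rewrite piIJE; apply/coherent_prod_rule.
    * move=> S1; rewrite piJE => /(coherent_prod_rule M0)/(_ w1 w2).
      exact: dispersions_neq.
  + split.
    * by move=> a t; rewrite piJE rhoE.
    * by move=> k t; rewrite piJE rhoE; exact: push_sel.
    * by move=> k; rewrite piJE rhoE; exact: defect_sel.
    * by move=> k; rewrite piJE defect_sel// /dispersion jeffreys_exp1 jeffreys_exp2;
        congr (tv (normalise (weight _)) (normalise (weight _))); field.
    * by move=> M' k M'0; rewrite piJE finite_jeffreysE// !defect_sel.
  + split.
    * split; first exact: mergeE.
      by rewrite mergeE rhoE; exact: merge_defect_ge.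
    * by rewrite piJE; exact: mass_outside_diagonal.
    * exact: merge_min.
    * move=> smin sminP; rewrite merge_min rhoE.
      exact: dispersion_le_min.
    * move=> M1 S76; apply/merge_min; rewrite rhoE.
      by apply: dispersion_le_small => //; rewrite ler_nat.
- split.
  + exact: example_marginal1.
  + exact: example_marginal4.
  + exact: example_defect_sel.
  + exact: example_defect_merge.
- move=> M cM; exact: defect_merge_bounds.
Qed.
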